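(* Let $k$ be a field, let $H$ be a finite-dimensional weak Hopf algebra over $k$, and let $A/B$ be a right weak $H$-Galois extension that is right faithfully flat (i.e. $A$ is faithfully flat as a right $B$-module). Suppose that $H$ is semisimple. If the finitistic dimension conjecture holds (that is, $\mathrm{fin.dim}\, R<\infty$ for every finite-dimensional $k$-algebra $R$), then $\mathrm{fin.dim}\, B=\mathrm{fin.dim}\, A$.
   Context: Everything is over a field $k$: vector spaces, algebras (associative, unital), coalgebras and the unadorned $\otimes$ are over $k$. Weak bialgebra: a weak $k$-bialgebra $H$ is both a $k$-algebra and a $k$-coalgebra $(\Delta,\varepsilon)$ such that $\Delta(hl)=\Delta(h)\Delta(l)$ and $$\Delta^2(1)=1_1\otimes 1_2 1'_1\otimes 1'_2=1_1\otimes 1'_1 1_2\otimes 1'_2,\qquad \varepsilon(hgl)=\varepsilon(hg_1)\varepsilon(g_2l)=\varepsilon(hg_2)\varepsilon(g_1l)$$ for all $h,g,l\in H$, where $\Delta^2(1)=(\Delta\otimes \mathrm{id})\Delta(1)$, $1'$ is another copy of $1$, and Sweedler notation $\Delta(h)=h_1\otimes h_2$ (summation omitted) is used. It is not required that $\Delta(1)=1\otimes 1$. The target and source maps $\varepsilon_t,\varepsilon_s:H\to H$ are $\varepsilon_t(h)=\varepsilon(1_1h)1_2$ and $\varepsilon_s(h)=1_1\varepsilon(h1_2)$; their images are denoted $H_t$ and $H_s$. Weak Hopf algebra: a weak bialgebra $H$ with a $k$-linear map $S:H\to H$ (antipode) such that $S*\mathrm{id}_H=\varepsilon_s$, $\mathrm{id}_H*S=\varepsilon_t$,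 $S*\mathrm{id}_H*S=S$, where $*$ is the convolution product. $H$ is semisimple if it is semisimple as an algebra. Right weak $H$-comodule algebra: an algebra $A$ with a right $H$-comodule structure $\rho_A=\rho:A\to A\otimes H$, $a\mapsto a_0\otimes a_1$ (summation omitted), such that $\rho(ab)=\rho(a)\rho(b)$ for all $a,b\in A$ and $\rho(1)=1_0\otimes 1_1\in A\otimes H_t$. Its coinvariants $B:=A^{coH}:=\{a\in A\mid \rho(a)=1_0a\otimes 1_1\}$ form a subalgebra of $A$. Right weak $H$-Galois extension: for a right weak $H$-comodule algebra $A$ with $B=A^{coH}$, put $A\otimes_t H:=(A\otimes H)\rho(1)=\{a1_0\otimes h1_1\mid a\in A,\ h\in H\}$ (spanned by these elements), and write $a\otimes_t h:=a1_0\otimes h1_1$. The extension $A/B$ is right weak $H$-Galois if the map $\beta:A\otimes_B A\to A\otimes_t H$, $a\otimes_B b\mapsto ab_0\otimes_t b_1$, is bijective. Finitistic dimension: for an algebra $R$, $\mathrm{fin.dim}\,R=\sup\{\mathrm{pd}_R M\mid M \text{ a finitely generated left } R\text{-module with } \mathrm{pd}_R M<\infty\}$, where $\mathrm{pd}_R M$ is the projective dimension of the left $R$-module $M$. *)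

(* Defs.v *)
From HB Require Import structures.
From mathcomp Require Import all_boot all_order all_algebra all_field.
From mathcomp Require Import generic_quotient.
From mathcomp Require Import boolp classical_sets functions constructive_ereal.

Set Implicit Arguments.
Unset Strict Implicit.
Unset Printing Implicit Defensive.

Import Order.TTheory GRing.Theory.
Local Open Scope classical_set_scope.
Local Open Scope ring_scope.
Local Open Scope quotient_scope.

Section Tensor.
Variables (R : Type) (M N : zmodType) (ra : M -> R -> M) (la : R -> N -> N).

Definition balanced (G : zmodType) (f : M -> N -> G) : Prop :=
  [/\ forall n, {morph f^~ n : x y / x + y},
      forall m, {morph f m : x y / x + y}
    & forall m r n, f (ra m r) n = f m (la r n)].

Definition tsum (G : zmodType) (f : M -> N -> G) (s : seq (M * N)) : G :=
  \sum_(p <- s) f p.1 p.2.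

(* A formal sum of pairs is a list; two of them give the same tensor when no
   balanced biadditive map separates them, which is the congruence generated by
   the usual relations. *)
Definition teq (s t : seq (M * N)) : bool :=
  `[< forall (G : zmodType) (f : M -> N -> G),
        balanced f -> tsum f s = tsum f t >].

Lemma teq_refl : reflexive teq.
Proof. by move=> s; apply/asboolP. Qed.

Lemma teq_sym : symmetric teq.
Proof.
by move=> s t; apply/asboolP/asboolP => h G f bf; rewrite (h G f bf).
Qed.

Lemma teq_trans : transitive teq.
Proof.
move=> t s u /asboolP h1 /asboolP h2; apply/asboolP => G f bf.
by rewrite (h1 G f bf) (h2 G f bf).
Qed.

Canonical teq_equiv := EquivRel teq teq_refl teq_sym teq_trans.

Definition tensor := {eq_quot teq}.

HB.instance Definition _ := Choice.on tensor.
HB.instance Definition _ := EqQuotient.on tensor.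

(* The value at t of the additive map m (x) n |-> f m n; it is independent of
   the representative of t as soon as f is balanced (tlift_pi, below). *)
Definition tlift (G : zmodType) (f : M -> N -> G) (t : tensor) : G :=
  tsum f (repr t).

Definition tpure (m : M) (n : N) : tensor := \pi_tensor [:: (m, n)].

Lemma tlift_pi (G : zmodType) (f : M -> N -> G) s :
  balanced f -> tlift f (\pi_tensor s) = tsum f s.
Proof.
move=> bf; have : repr (\pi_tensor s) = s %[mod tensor] by rewrite reprK.
by move=> /eqquotP/asboolP; exact.
Qed.

Lemma tensorP (x y : tensor) :
  (forall (G : zmodType) (f : M -> N -> G), balanced f ->
     tlift f x = tlift f y) -> x = y.
Proof.
move=> h; rewrite -[x]reprK -[y]reprK; apply/eqquotP/asboolP => G f bf.
exact: h.
Qed.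

Lemma tlift_pure (G : zmodType) (f : M -> N -> G) m n :
  balanced f -> tlift f (tpure m n) = f m n.
Proof. by move=> bf; rewrite tlift_pi// /tsum big_seq1. Qed.

Lemma balancedN (G : zmodType) (f : M -> N -> G) m n :
  balanced f -> f (- m) n = - f m n.
Proof.
case=> fD _ _; apply/eqP; rewrite -addr_eq0 -fD addNr.
by have /eqP := fD n 0 0; rewrite addr0 -subr_eq0 opprD addrA subrr add0r oppr_eq0.
Qed.

Definition tzero : tensor := \pi_tensor [::].
Definition tadd (x y : tensor) : tensor := \pi_tensor (repr x ++ repr y).
Definition topp (x : tensor) : tensor :=
  \pi_tensor [seq (- p.1, p.2) | p <- repr x].

Lemma tlift_tzero (G : zmodType) (f : M -> N -> G) :
  balanced f -> tlift f tzero = 0.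
Proof. by move=> bf; rewrite tlift_pi// /tsum big_nil. Qed.

Lemma tlift_tadd (G : zmodType) (f : M -> N -> G) x y :
  balanced f -> tlift f (tadd x y) = tlift f x + tlift f y.
Proof. by move=> bf; rewrite tlift_pi// /tsum big_cat. Qed.

Lemma tlift_topp (G : zmodType) (f : M -> N -> G) x :
  balanced f -> tlift f (topp x) = - tlift f x.
Proof.
move=> bf; rewrite tlift_pi// /tsum big_map -sumrN.
by apply: eq_bigr => p _ /=; rewrite balancedN.
Qed.

Lemma taddA : associative tadd.
Proof. by move=> x y z; apply: tensorP => G f bf; rewrite !tlift_tadd// addrA. Qed.
Lemma taddC : commutative tadd.
Proof. by move=> x y; apply: tensorP => G f bf; rewrite !tlift_tadd// addrC. Qed.
Lemma tadd0 : left_id tzero tadd.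
Proof.
by move=> x; apply: tensorP => G f bf; rewrite tlift_tadd// tlift_tzero// add0r.
Qed.
Lemma taddN : left_inverse tzero topp tadd.
Proof.
move=> x; apply: tensorP => G f bf.
by rewrite tlift_tadd// tlift_tzero// tlift_topp// addNr.
Qed.

HB.instance Definition _ := GRing.isZmodule.Build tensor taddA taddC tadd0 taddN.

Lemma tliftD (G : zmodType) (f : M -> N -> G) :
  balanced f -> {morph tlift f : x y / x + y}.
Proof. by move=> bf x y; exact: tlift_tadd. Qed.

Lemma tpure_balanced : balanced tpure.
Proof.
split=> [n x y|m x y|m r n]; apply: tensorP => G f bf;
  rewrite ?tliftD// !tlift_pure//; case: bf => fl fr fb.
- exact: fl.
- exact: fr.
- exact: fb.
Qed.

Lemma tensor_sum (t : tensor) : t = \sum_(p <- repr t) tpure p.1 p.2.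
Proof.
apply: tensorP => G f bf; rewrite {1}/tlift /tsum.
elim: (repr t) => [|p s IH]; first by rewrite !big_nil tlift_tzero.
by rewrite !big_cons tliftD// tlift_pure// IH.
Qed.

End Tensor.

Arguments tpure {R M N ra la} m n.
Arguments tlift {R M N ra la G} f t.

Section TensorK.
Variables (k : comPzRingType) (M N : lmodType k).

Definition ktensor := tensor (fun (m : M) (c : k) => c *: m) (@GRing.scale k N).

HB.instance Definition _ := GRing.Zmodule.on ktensor.

Definition kbalanced (G : zmodType) (f : M -> N -> G) : Prop :=
  balanced (fun (m : M) (c : k) => c *: m) (@GRing.scale k N) f.

Definition kpure (m : M) (n : N) : ktensor := tpure m n.
Definition klift (G : zmodType) (f : M -> N -> G) (t : ktensor) : G := tlift f t.

Definition kscale (c : k) (t : ktensor) : ktensor :=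
  \pi_ktensor [seq (c *: p.1, p.2) | p <- repr t].

Lemma kbalancedZ (G : zmodType) (f : M -> N -> G) c :
  kbalanced f -> kbalanced (fun m => f (c *: m)).
Proof.
case=> fl fr fb; split=> [n x y|m x y|m r n] /=.
- by rewrite scalerDr fl.
- exact: fr.
- by rewrite -fb !scalerA mulrC.
Qed.

Lemma klift_scale (G : zmodType) (f : M -> N -> G) c t :
  kbalanced f -> klift f (kscale c t) = klift (fun m => f (c *: m)) t.
Proof. by move=> bf; rewrite /klift tlift_pi// /tsum big_map. Qed.

Lemma kscaleA a b t : kscale a (kscale b t) = kscale (a * b) t.
Proof.
apply: tensorP => G f bf.
rewrite -!/(klift _ _) !klift_scale//; last exact: kbalancedZ.
by rewrite /klift /tlift /tsum; apply: eq_bigr => p _; rewrite scalerA mulrC.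
Qed.

Lemma kscale1 : left_id 1 kscale.
Proof.
move=> t; apply: tensorP => G f bf; rewrite -!/(klift _ _) klift_scale//.
by rewrite /klift /tlift /tsum; apply: eq_bigr => p _; rewrite scale1r.
Qed.

Lemma kscaleDr : right_distributive kscale +%R.
Proof.
move=> c x y; apply: tensorP => G f bf.
rewrite tliftD// -!/(klift _ _) !klift_scale//.
by rewrite /klift tliftD//; exact: kbalancedZ.
Qed.

Lemma kscaleDl t : {morph kscale^~ t : a b / a + b}.
Proof.
move=> a b; apply: tensorP => G f bf.
rewrite tliftD// -!/(klift _ _) !klift_scale// /klift /tlift /tsum -big_split.
by apply: eq_bigr => p _ /=; rewrite scalerDl; case: bf => ->.
Qed.

HB.instance Definition _ :=
  GRing.Zmodule_isLmodule.Build k ktensor kscaleA kscale1 kscaleDr kscaleDl.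

End TensorK.

Declare Scope tensor_scope.
Delimit Scope tensor_scope with T.
Local Open Scope tensor_scope.

Notation "M '⊗' N" := (ktensor M N) (at level 40, left associativity) : type_scope.
Notation "m '⊗' n" := (kpure m n) (at level 40, left associativity) : tensor_scope.

(* Sweedler notation: E must be bilinear in x and y. *)
Notation "'Σ[' x , y '<-' t ']' E" := (klift (fun x y => E) t)
  (at level 41, x name, y name, t at level 200, E at level 41,
   format "'Σ[' x ,  y  '<-'  t ]  E") : tensor_scope.

Section TensorAlgebra.
Variables (k : fieldType) (A H : algType k).

Definition kmul (s t : A ⊗ H) : A ⊗ H :=
  Σ[a, h <- s] Σ[b, l <- t] (a * b) ⊗ (h * l).

Lemma kpureD2 (a : A) (h l : H) : a ⊗ (h + l) = a ⊗ h + a ⊗ l.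
Proof. by rewrite /kpure; case: (tpure_balanced (fun (m : A) (c : k) => c *: m)
  (@GRing.scale k H)) => _ ->. Qed.

Lemma kpureD1 (a b : A) (h : H) : (a + b) ⊗ h = a ⊗ h + b ⊗ h.
Proof. by rewrite /kpure; case: (tpure_balanced (fun (m : A) (c : k) => c *: m)
  (@GRing.scale k H)) => ->. Qed.

Lemma kpureC (c : k) (a : A) (h : H) : (c *: a) ⊗ h = a ⊗ (c *: h).
Proof. by rewrite /kpure; case: (tpure_balanced (fun (m : A) (c : k) => c *: m)
  (@GRing.scale k H)) => _ _ ->. Qed.

Lemma kpureZ (c : k) (a : A) (h : H) : c *: (a ⊗ h) = (c *: a) ⊗ h.
Proof.
apply: tensorP => G f bf; rewrite -!/(klift _ _) klift_scale//.
by rewrite /klift !tlift_pure//; exact: kbalancedZ.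
Qed.

Lemma klift_klift (G : zmodType) (f : A -> H -> G) (g : A -> H -> A ⊗ H) t :
  kbalanced f -> klift f (Σ[a, h <- t] g a h) = Σ[a, h <- t] klift f (g a h).
Proof.
move=> bf; change (klift f (\sum_(p <- repr t) g p.1 p.2) =
  \sum_(p <- repr t) klift f (g p.1 p.2)).
elim: (repr t) => [|p s IH]; first by rewrite !big_nil /klift tlift_tzero.
by rewrite !big_cons -IH /klift tliftD.
Qed.

Lemma klift_pure (G : zmodType) (f : A -> H -> G) a h :
  kbalanced f -> klift f (a ⊗ h) = f a h.
Proof. exact: tlift_pure. Qed.

Lemma kbalanced_mul (b b' : A) (l l' : H) :
  kbalanced (fun a h => (b * a * b') ⊗ (l * h * l')).
Proof.
split=> [h a a'|a h h'|a c h] /=; rewrite ?(mulrDl, mulrDr) ?kpureD1 ?kpureD2//.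
by rewrite -!scalerAr -!scalerAl kpureC.
Qed.

Lemma kbalanced_mulr (b : A) : kbalanced (fun a (h : H) => (a * b) ⊗ h).
Proof.
have := kbalanced_mul 1 b 1 1; congr (kbalanced _).
by apply/funext => a; apply/funext => h; rewrite !mul1r mulr1.
Qed.

Lemma kmul_mulr (b : A) s t :
  kmul s (Σ[u, v <- t] (u * b) ⊗ v) = Σ[u, v <- kmul s t] (u * b) ⊗ v.
Proof.
have bal a h : kbalanced (fun (c : A) (l : H) => (a * c) ⊗ (h * l)).
  have := kbalanced_mul a 1 h 1; congr (kbalanced _).
  by apply/funext => c; apply/funext => l; rewrite !mulr1.
rewrite /kmul klift_klift; last exact: kbalanced_mulr.
congr (klift _ s); apply/funext => a; apply/funext => h.
rewrite !klift_klift//; last exact: kbalanced_mulr.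
congr (klift _ t); apply/funext => c; apply/funext => l.
by rewrite !klift_pure//; [rewrite mulrA | exact: kbalanced_mulr].
Qed.

End TensorAlgebra.

Section WeakHopf.
Variables (k : fieldType) (H : algType k).

Record coalgebra := Coalgebra {
  comul : {linear H -> (H ⊗ H)%type};
  counit : {scalar H};
  comulA : forall h,
    Σ[h1, h2 <- comul h] Σ[x, y <- comul h1] (x ⊗ y) ⊗ h2
    = Σ[h1, h2 <- comul h] Σ[x, y <- comul h2] (h1 ⊗ x) ⊗ y;
  counitL : forall h, Σ[h1, h2 <- comul h] counit h1 *: h2 = h;
  counitR : forall h, Σ[h1, h2 <- comul h] counit h2 *: h1 = h
}.

Record weakBialgebra := WeakBialgebra {
  wb_coalgebra :> coalgebra;
  comulM : forall h l,
    comul wb_coalgebra (h * l)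
    = kmul (comul wb_coalgebra h) (comul wb_coalgebra l);
  comul1L :
    Σ[x, y <- comul wb_coalgebra 1] Σ[u, v <- comul wb_coalgebra x] (u ⊗ v) ⊗ y
    = Σ[x, y <- comul wb_coalgebra 1] Σ[x', y' <- comul wb_coalgebra 1]
        (x ⊗ (y * x')) ⊗ y';
  comul1R :
    Σ[x, y <- comul wb_coalgebra 1] Σ[u, v <- comul wb_coalgebra x] (u ⊗ v) ⊗ y
    = Σ[x, y <- comul wb_coalgebra 1] Σ[x', y' <- comul wb_coalgebra 1]
        (x ⊗ (x' * y)) ⊗ y';
  counitML : forall h g l,
    counit wb_coalgebra (h * g * l)
    = Σ[g1, g2 <- comul wb_coalgebra g]
        (counit wb_coalgebra (h * g1) * counit wb_coalgebra (g2 * l));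
  counitMR : forall h g l,
    counit wb_coalgebra (h * g * l)
    = Σ[g1, g2 <- comul wb_coalgebra g]
        (counit wb_coalgebra (h * g2) * counit wb_coalgebra (g1 * l))
}.

Definition eps_t (C : weakBialgebra) (h : H) : H :=
  Σ[x, y <- comul C 1] counit C (x * h) *: y.

Definition eps_s (C : weakBialgebra) (h : H) : H :=
  Σ[x, y <- comul C 1] counit C (h * y) *: x.

Definition convolution (C : coalgebra) (f g : H -> H) (h : H) : H :=
  Σ[h1, h2 <- comul C h] (f h1 * g h2).

Record weakHopf := WeakHopf {
  wh_bialgebra :> weakBialgebra;
  antipode : {linear H -> H};
  antipodeL : convolution wh_bialgebra antipode id =1 eps_s wh_bialgebra;
  antipodeR : convolution wh_bialgebra id antipode =1 eps_t wh_bialgebra;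
  antipodeM :
    convolution wh_bialgebra (convolution wh_bialgebra antipode id) antipode
    =1 antipode
}.

End WeakHopf.

Section Semisimple.
Variables (k : fieldType) (H : falgType k).

Definition left_ideal (I : {vspace H}) : Prop := ({:H} * I <= I)%VS.

Definition simple_left_ideal (I : {vspace H}) : Prop :=
  [/\ left_ideal I, I != 0%VS
    & forall J : {vspace H}, left_ideal J -> (J <= I)%VS -> J = 0%VS \/ J = I].

Definition semisimple_algebra : Prop :=
  exists n (I : 'I_n -> {vspace H}),
    [/\ forall i, simple_left_ideal (I i),
        directv (\sum_i I i) & (\sum_i I i = {:H})%VS].

End Semisimple.

Section ComoduleAlgebra.
Variables (k : fieldType) (H : algType k) (C : weakBialgebra H) (A : algType k).

Record comoduleAlgebra := ComoduleAlgebra {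
  coact :> {linear A -> (A ⊗ H)%type};
  coactA : forall a,
    Σ[a0, a1 <- coact a] Σ[x, y <- coact a0] (x ⊗ y) ⊗ a1
    = Σ[a0, a1 <- coact a] Σ[x, y <- comul C a1] (a0 ⊗ x) ⊗ y;
  coact_counit : forall a, Σ[a0, a1 <- coact a] counit C a1 *: a0 = a;
  coactM : forall a b, coact (a * b) = kmul (coact a) (coact b);
  (* coact 1 lies in A (x) H_t *)
  coact1 : exists s : seq (A * H),
    (forall p, p \in s -> range (eps_t C) p.2)
    /\ coact 1 = \sum_(p <- s) p.1 ⊗ p.2
}.

Variable rho : comoduleAlgebra.

Definition coinvariant : {pred A} :=
  fun a => `[< rho a = Σ[u, v <- rho 1] (u * a) ⊗ v >].

Lemma coinvariant_subalg : subalg_closed coinvariant.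
Proof.
split=> [|c a b /asboolP ha /asboolP hb|a b /asboolP ha /asboolP hb];
  apply/asboolP.
- rewrite [LHS]tensor_sum /klift /tlift /tsum.
  by apply: eq_bigr => p _; rewrite mulr1.
- rewrite linearP ha hb /klift /tlift /tsum scaler_sumr -big_split.
  by apply: eq_bigr => p _ /=; rewrite mulrDr -scalerAr kpureD1 kpureZ.
- rewrite coactM hb kmul_mulr -coactM mulr1 ha klift_klift; last first.
    exact: kbalanced_mulr.
  congr (klift _ _); apply/funext => u; apply/funext => v.
  by rewrite klift_pure ?mulrA//; exact: kbalanced_mulr.
Qed.

HB.instance Definition _ :=
  GRing.isSubalgClosed.Build k A coinvariant coinvariant_subalg.

Record coinv := Coinv { coinv_val : A; coinvP : coinv_val \in coinvariant }.

HB.instance Definition _ := [isSub for coinv_val].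
HB.instance Definition _ := [Choice of coinv by <:].
HB.instance Definition _ := [SubChoice_isSubAlgebra of coinv by <:].

Definition tensor_t : set (A ⊗ H)%type := range (fun t : (A ⊗ H)%type => kmul t (rho 1)).

Definition pure_t (a : A) (h : H) : A ⊗ H :=
  Σ[u, v <- rho 1] (a * u) ⊗ (h * v).

Definition coinv_ract (a : A) (b : coinv) : A := a * val b.
Definition coinv_lact (b : coinv) (a : A) : A := val b * a.

(* The assignment a, b |-> a b_0 (x)_t b_1 is balanced over the coinvariants,
   since rho b = 1_0 b (x) 1_1 lies in A (x) H_t and hence also equals
   b 1_0 (x) 1_1; beta is the unique additive map that it induces. *)
Definition weak_galois : Prop :=
  exists beta : {additive tensor coinv_ract coinv_lact -> (A ⊗ H)%type},
    (forall a b : A, beta (tpure a b) = Σ[b0, b1 <- rho b] pure_t (a * b0) b1)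
    /\ set_bij [set: tensor coinv_ract coinv_lact] tensor_t beta.

End ComoduleAlgebra.

Arguments coinv_ract {k H C A} rho a b.
Arguments coinv_lact {k H C A} rho b a.

Section Modules.
Variable R : pzRingType.

Definition exact (X Y Z : zmodType) (f : X -> Y) (g : Y -> Z) : Prop :=
  [set y | g y = 0] = range f.

(* id (x) f on M (x)_R X, M being a right R-module through ra *)
Definition tensor_map (M : zmodType) (ra : M -> R -> M) (X Y : lmodType R)
    (f : X -> Y) : tensor ra (@GRing.scale R X) -> tensor ra (@GRing.scale R Y) :=
  tlift (fun m x => tpure m (f x)).
Arguments tensor_map {M} ra {X Y} f.

Definition faithfully_flat (M : zmodType) (ra : M -> R -> M) : Prop :=
  forall (X Y Z : lmodType R) (f : {linear X -> Y}) (g : {linear Y -> Z}),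
    exact f g <-> exact (tensor_map ra f) (tensor_map ra g).

Definition projective (P : lmodType R) : Prop :=
  forall (X Y : lmodType R) (g : {linear X -> Y}) (f : {linear P -> Y}),
    set_surj [set: X] [set: Y] g ->
    exists h : {linear P -> X}, forall p, g (h p) = f p.

Definition projective_resolution (M : lmodType R) (n : nat) : Prop :=
  exists (P : nat -> lmodType R) (d : forall i, {linear P i.+1 -> P i})
         (e : {linear P 0%N -> M}),
    [/\ forall i, projective (P i),
        forall i, (n < i)%N -> forall x : P i, x = 0,
        set_surj [set: P 0%N] [set: M] e,
        exact (d 0%N) e
      & forall i, exact (d i.+1) (d i)].

(* With this convention the zero module has dimension 0; the value is +oo when
   there is no finite projective resolution. *)
Definition proj_dim (M : lmodType R) : \bar int :=
  infimum +oo%E [set (n%:Z)%:E%E | n in projective_resolution M].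

Definition finitely_generated (M : lmodType R) : Prop :=
  exists n (g : 'I_n -> M), forall x, exists c : 'I_n -> R,
    x = \sum_i c i *: g i.

Definition fin_dim : \bar int :=
  supremum 0%E [set d | exists M : lmodType R,
    [/\ finitely_generated M, (proj_dim M < +oo)%E & d = proj_dim M]].

End Modules.

(* Main.v *)
(* Both A (x)_B - and restriction of scalars preserve finite projective dimension,
   so the two suprema are taken over the same set of values.  This rests on three
   structural facts about a Galois extension A/B.
   - The functionals T with h_1 T(h_2) in H_t give left B-linear maps
     a |-> a_0 T(a_1) from A to B.  A trace formula involving S^2 produces enough
     of them to write the counit as a sum of functionals h |-> T(h S(z)), and with
     x (x) y = beta^-1 (1 (x)_t z) this becomes a finite left dual basis: A is a
     finitely generated projective left B-module.
   - Semisimplicity gives L in H with L h = L eps_s(h) and eps_s(L) = 1, and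
     beta^-1 (1 (x)_t L) is a separability element of A/B.
   - Faithful flatness yields a colinear map j : H -> A with j(1) = 1: colinear
     maps form the kernel of a B-linear map, and after tensoring with A the family
     h |-> beta^-1 (1 (x)_t h) lies in it.  Then a |-> a_0 j(S(a_1)) is a left
     B-linear retraction of B into A.
   The first two facts give pd_A X = pd_B X for every A-module X.  Flatness gives
   pd_A (A (x)_B M) <= pd_B M, and the retraction lets one descend a splitting of
   the last map of a finite projective resolution, whence equality. *)
Require Import Defs.
From HB Require Import structures.
From mathcomp Require Import all_boot all_order all_algebra all_field.
From mathcomp Require Import generic_quotient.
From mathcomp Require Import boolp classical_sets functions constructive_ereal.

Set Implicit Arguments.
Unset Strict Implicit.
Unset Printing Implicit Defensive.

Import Order.TTheory GRing.Theory.
Local Open Scope classical_set_scope.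
Local Open Scope ring_scope.
Local Open Scope tensor_scope.

(** * Projective dimension *)

(** A retraction p : S -> R that is only left R-linear induces no map p (x) id on S (x)_R M, which
    is formed with the right action on S. It does induce one when M = R (x)_Z P, because there the
    product s a is formed before p is applied, and then for projective M by splitting R (x)_Z M ->
    M. Only the projective kernel at the end of a resolution can therefore be retracted: descent
    improves a bound pd M <= n + 1 to n, and needs a finite bound to begin with, which the
    definition of fin.dim supplies.

    The inverse of beta is never formed as a map. For each h a formal sum of pairs with prescribed
    image under beta is chosen, and injectivity of beta says that balanced maps do not see the
    choice. In the same spirit, identities in tensor products over the field are stated for
    arbitrary multilinear test maps F, so that Sweedler calculus becomes rewriting under finite
    sums. *)

Definition Linear (R : pzRingType) (U V : lmodType R) (f : U -> V)
    (lf : linear f) : {linear U -> V} :=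
  HB.pack f (GRing.isLinear.Build R U V *:%R f lf).

(** * Kernels of linear maps as modules *)

Section Kernel.
Variables (R : pzRingType) (U V : lmodType R) (f : {linear U -> V}).

Definition in_ker : {pred U} := fun x => f x == 0.

Lemma in_ker_closed : submod_closed in_ker.
Proof.
split=> [|c x y /eqP fx /eqP fy]; apply/eqP; first exact: raddf0.
by rewrite linearP fx fy scaler0 addr0.
Qed.

HB.instance Definition _ :=
  GRing.isSubmodClosed.Build R U in_ker in_ker_closed.

Record ker := Ker { ker_val : U; ker_valP : ker_val \in in_ker }.

HB.instance Definition _ := [isSub for ker_val].
HB.instance Definition _ := [Choice of ker by <:].
HB.instance Definition _ := [SubChoice_isSubLmodule of ker by <:].

Definition ker_incl : {linear ker -> U} := \val.

Lemma ker_inclK (x : ker) : f (ker_incl x) = 0.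
Proof. by apply/eqP; case: x. Qed.

Lemma ker_exact : exact ker_incl f.
Proof.
apply/seteqP; split=> [x /= /eqP fx|_ [x _ <-] /=]; last exact: ker_inclK.
by exists (Ker fx).
Qed.

Variables (W : lmodType R) (g : {linear W -> U}) (fg : forall x, f (g x) = 0).

Definition ker_lift_fun (x : W) : ker := Ker (introT eqP (fg x)).

Lemma ker_lift_linear : linear ker_lift_fun.
Proof. by move=> c x y; apply: val_inj; rewrite /= linearP. Qed.

Definition ker_lift : {linear W -> ker} := Linear ker_lift_linear.

End Kernel.

(** * Projective modules and dimension shifting *)

Section Projective.
Variable R : pzRingType.
Implicit Types M N P K X Y : lmodType R.

Lemma exactP (X Y Z : zmodType) (f : X -> Y) (g : Y -> Z) :
  exact f g <-> (forall x, g (f x) = 0) /\ (forall y, g y = 0 -> exists x, f x = y).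
Proof.
split=> [e|[gf fg]]; last first.
  by apply/seteqP; split=> [y /fg[x <-]|_ [x _ <-]]; [exists x|exact: gf].
split=> [x|y gy].
  by have : range f (f x) by [exists x]; rewrite -e.
by have [x _ <-] : range f y by [rewrite -e]; exists x.
Qed.

Lemma surjP (T U : Type) (f : T -> U) :
  set_surj [set: T] [set: U] f <-> forall y, exists x, f x = y.
Proof.
split=> [s y|s y _]; first by have [x _ <-] := s y I; exists x.
by have [x <-] := s y; exists x.
Qed.

Lemma projective_retract M N (i : {linear N -> M}) (r : {linear M -> N}) :
  cancel i r -> projective M -> projective N.
Proof.
move=> irK pM X Y g f sg; have [h gh] := pM X Y g (f \o r) sg.
by exists (h \o i) => x; rewrite /= gh /= irK.
Qed.

Lemma projective_pair M N :
  projective M -> projective N -> projective (M * N)%type.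
Proof.
move=> pM pN X Y g f sg.
have lM : linear (fun x => f (x, 0)).
  by move=> c x y; rewrite -linearP; congr (f _); rewrite -[RHS]/(_, _) /= scaler0 addr0.
have lN : linear (fun x => f (0, x)).
  by move=> c x y; rewrite -linearP; congr (f _); rewrite -[RHS]/(_, _) /= scaler0 addr0.
have [h gh] := pM X Y g (Linear lM) sg; have [l gl] := pN X Y g (Linear lN) sg.
have lhl : linear (fun z : M * N => h z.1 + l z.2).
  by move=> c x y; rewrite /= !linearP scalerDr addrACA.
exists (Linear lhl) => -[x y] /=; rewrite raddfD /= gh gl /= -raddfD.
by congr (f _); rewrite -[LHS]/(_, _) /= addr0 add0r.
Qed.

Lemma projective_zero M : (forall x : M, x = 0) -> projective M.
Proof.
move=> M0 X Y g f sg; exists (@GRing.null_fun M X) => x.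
by rewrite (M0 x) !raddf0.
Qed.

Lemma projective_section P M (e : {linear M -> P}) :
  projective P -> (forall y, exists x, e x = y) ->
  exists s : {linear P -> M}, cancel s e.
Proof. by move=> pP /surjP se; have [s sK] := pP M P e idfun se; exists s. Qed.

(** Recursion on one short exact sequence at a time replaces the infinite complex of
    [projective_resolution], so that dimension arguments become inductions on n. *)
Fixpoint pd_le (n : nat) M : Prop :=
  if n is n'.+1 then
    exists P K (i : {linear K -> P}) (e : {linear P -> M}),
      [/\ projective P, injective i, exact i e,
          forall y, exists x, e x = y & pd_le n' K]
  else projective M.

Lemma ker_pd_le n M P (e : {linear P -> M}) :
  projective P -> (forall y, exists x, e x = y) -> pd_le n (ker e) -> pd_le n.+1 M.
Proof.
move=> pP se pdK; exists P, (ker e), (ker_incl e), e.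
by split=> //; exact: ker_exact.
Qed.

Lemma pd_le_pair n M P : pd_le n M -> projective P -> pd_le n (M * P)%type.
Proof.
case: n => [|n] /=; first exact: projective_pair.
move=> [Q [K [i [e [pQ ii ie se pdK]]]]] pP.
have [ei0 ei1] := iffLR (exactP _ _) ie.
have lj : linear (fun x : K => (i x, 0 : P)).
  by move=> c x y; rewrite linearP -[RHS]/(_, _) /= scaler0 addr0.
have ld : linear (fun z : Q * P => (e z.1, z.2)).
  by move=> c x y; rewrite /= linearP.
exists (Q * P)%type, K, (Linear lj), (Linear ld); split=> //=.
- exact: projective_pair.
- by move=> x y /= [/ii].
- apply/exactP; split=> [x|[x y] /=]; first by rewrite /= ei0.
  by move=> [/ei1[z <-] ->]; exists z.
- by move=> [x y]; have [z <-] := se x; exists (z, y).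
Qed.

(* Schanuel's lemma, for the idempotent of M with image N: a lift a of it to
   a projective module P over M makes the kernel of P -> N a retract of
   ker (P -> M) x P. *)
Lemma pd_le_retract n M N (i : {linear N -> M}) (r : {linear M -> N}) :
  cancel i r -> pd_le n M -> pd_le n N.
Proof.
elim: n M N i r => [|n IH] M N i r irK; first exact: projective_retract irK.
move=> [P [K [j [e [pP ij je se pdK]]]]].
have [ej0 ej1] := iffLR (exactP _ _) je.
have [a ea] := pP P M e (i \o r \o e) (iffRL (surjP _) se).
apply: (ker_pd_le (e := r \o e) pP).
  by move=> y; have [x ex] := se (i y); exists x; rewrite /= ex.
set L := ker _.
have ker0 (x : L) : r (e (ker_incl _ x)) = 0 by exact: (ker_inclK x).
have pick (x : L) : exists y : K, j y = a (ker_incl _ x).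
  by apply: ej1; rewrite ea /= ker0 raddf0.
have [s sE] := choice pick.
have ls : linear (fun x : L => (s x, ker_incl _ x)).
  move=> c x y; rewrite linearP; congr (_, _); apply: ij.
  by rewrite [RHS]linearP !sE !linearP.
have rt0 z : (r \o e) (j z.1 + (z.2 - a z.2)) = 0.
  by rewrite /= !raddfD !raddfN /= ej0 ea /= irK subrr raddf0 addr0.
pose t : {linear (K * P)%type -> L} :=
  ker_lift (f := r \o e) (g := (j \o fst) \+ ((idfun \- a) \o snd)) rt0.
apply: (IH _ _ (Linear ls) t); last exact: pd_le_pair.
by move=> x; apply: val_inj; rewrite /= sE addrC subrK.
Qed.

(** Schanuel's comparison: lifts a and b between the two projective presentations of M make K a
    retract of K' x P, so the bound on the syzygy does not depend on the presentation. *)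
Lemma pd_le_syzygy n M P K (i : {linear K -> P}) (e : {linear P -> M}) :
  projective P -> injective i -> exact i e -> (forall y, exists x, e x = y) ->
  pd_le n.+1 M -> pd_le n K.
Proof.
move=> pP ii /exactP[ei0 ei1] se [P' [K' [i' [e' [pP' ii' /exactP[e0' e1'] se' pdK]]]]].
have [a ea] := pP P' M e' e (iffRL (surjP _) se').
have [b eb] := pP' P M e e' (iffRL (surjP _) se).
have pick x : exists y : K', i' y = a (i x) by apply: e1'; rewrite ea.
have [s sE] := choice pick.
have ls : linear (fun x => (s x, i x)).
  move=> c x y; rewrite linearP; congr (_, _); apply: ii'.
  by rewrite [RHS]linearP !sE !linearP.
have pick' (z : K' * P) : exists y, i y = b (i' z.1) + (z.2 - b (a z.2)).
  by apply: ei1; rewrite !raddfD raddfN /= !eb ea e0' add0r subrr.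
have [t tE] := choice pick'.
have lt : linear t.
  move=> c x y; apply: ii; rewrite linearP !tE.
  pose u : {linear (K' * P)%type -> P} :=
    (b \o i' \o fst) \+ ((idfun \- (b \o a)) \o snd).
  exact: (linearP u).
apply: (pd_le_retract (i := Linear ls) (r := Linear lt)); last exact: pd_le_pair pdK pP.
by move=> x; apply: ii; rewrite /= tE /= sE addrC subrK.
Qed.

Lemma pd_leS n M : pd_le n M -> pd_le n.+1 M.
Proof.
elim: n M => [M pM|n IH M [P [K [i [e [pP ii ie se pdK]]]]]]; last first.
  by exists P, K, i, e; split=> //; exact: IH.
exists M, ('rV[R]_0 : lmodType R), (@GRing.null_fun 'rV[R]_0 M : {linear _ -> _}).
exists (idfun : {linear M -> M}); split=> //.
- by move=> x y _; rewrite [x]thinmx0 [y]thinmx0.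
- by apply/exactP; split=> [//|y /= ->]; exists 0.
- by move=> y; exists y.
- by apply: projective_zero => x; rewrite [x]thinmx0.
Qed.

Lemma inverse_linear M N (e : {linear M -> N}) :
  injective e -> (forall y, exists x, e x = y) ->
  exists s : {linear N -> M}, cancel s e.
Proof.
move=> ie /choice[s sE].
have ls : linear s by move=> c x y; apply: ie; rewrite linearP !sE.
by exists (Linear ls).
Qed.

(** Cutting a resolution at [P 0] leaves a shorter one of the kernel of [e], and splicing reverses
    this. At n = 0 the module [P 1] vanishes, so [e] is bijective. *)
Lemma resolution_pd_le n M : projective_resolution M n <-> pd_le n M.
Proof.
elim: n M => [|n IH] M; split.
- move=> [P [d [e [pP P0 /surjP se /exactP[_ de] _]]]].
  have ie : injective e.
    by apply: raddf_inj => x /de[y <-]; rewrite (P0 1%N _ y) ?raddf0.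
  by have [s sK] := inverse_linear ie se; exact: projective_retract sK (pP 0%N).
- move=> pM; pose Z : lmodType R := 'rV[R]_0.
  have Z0 (x : Z) : x = 0 by rewrite [x]thinmx0.
  pose P i : lmodType R := if i is 0%N then M else Z.
  exists P, (fun i => @GRing.null_fun (P i.+1) (P i)).
  exists (idfun : {linear M -> M}); split=> [[|i]|[|i]|||[|i]] //=.
  + exact: projective_zero.
  + by apply/exactP; split=> [//|y /= ->]; exists 0.
  + by apply/exactP; split=> [//|y _]; exists 0; rewrite [RHS]Z0.
  + by apply/exactP; split=> [//|y _]; exists 0; rewrite [RHS]Z0.
- move=> [P [d [e [pP P0 /surjP se /exactP[de0 de1] dd]]]].
  apply: (ker_pd_le (e := e) (pP 0%N) se); apply/IH.
  exists (fun i => P i.+1), (fun i => d i.+1), (ker_lift de0); split=> //.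
  + by move=> i ni x; exact: P0.
  + apply/surjP => y; have [x xy] := de1 _ (ker_inclK y).
    by exists x; apply: val_inj.
  + have [dd0 dd1] := iffLR (exactP _ _) (dd 0%N).
    apply/exactP; split=> [x|y /(congr1 val) /= y0]; last exact: dd1.
    by apply: val_inj; rewrite /= dd0.
- move=> [Q [K [i [e [pQ ii ie se /IH[P [d [f [pP P0 /surjP sf df dd]]]]]]]]].
  pose P' j : lmodType R := if j is j'.+1 then P j' else Q.
  pose d' j : {linear P' j.+1 -> P' j} := if j is j'.+1 then d j' else i \o f.
  have [ie0 ie1] := iffLR (exactP _ _) ie; have [df0 df1] := iffLR (exactP _ _) df.
  exists P', d', e; split=> [[|j]|[|j]|||[|j]] //=.
  + by move=> nj x; exact: P0.
  + exact/surjP.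
  + apply/exactP; split=> [x|y /ie1[x <-]]; first exact: ie0.
    by have [z fz] := sf x; exists z; rewrite /= fz.
  + apply/exactP; split=> [x|y /= iy]; first by rewrite /= df0 raddf0.
    by apply: df1; apply: ii; rewrite iy raddf0.
Qed.

Lemma proj_dim_finite M : (proj_dim M < +oo)%E -> exists n, pd_le n M.
Proof.
apply: contraPP => /forallNP nM; rewrite /proj_dim.
(* On the empty set [infimum] takes its default value [+oo]. *)
suff -> : [set (n%:Z)%:E%E | n in projective_resolution M] = set0.
  by rewrite /infimum eqxx ltxx.
by apply/seteqP; split=> // d [n /resolution_pd_le pdM _]; exact: nM pdM.
Qed.

End Projective.

Lemma eq_proj_dim (R S : pzRingType) (M : lmodType R) (N : lmodType S) :
  (forall n, pd_le n M <-> pd_le n N) -> proj_dim M = proj_dim N.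
Proof.
move=> e; congr (infimum _ _); apply/seteqP.
by split=> _ [n h <-] /=; exists n => //; apply/resolution_pd_le/e/resolution_pd_le.
Qed.

(** * Base change along a ring morphism *)

Lemma tensor_ind (R : Type) (M N : zmodType) (ra : M -> R -> M) (la : R -> N -> N)
    (P : tensor ra la -> Prop) :
  P 0 -> (forall x y, P x -> P y -> P (x + y)) -> (forall m n, P (tpure m n)) ->
  forall t, P t.
Proof. by move=> P0 PD Pp t; rewrite [t]tensor_sum; apply: big_ind. Qed.

Lemma tensor_ext (R : Type) (M N G : zmodType) (ra : M -> R -> M)
    (la : R -> N -> N) (f g : tensor ra la -> G) :
  {morph f : x y / x + y} -> {morph g : x y / x + y} ->
  (forall m n, f (tpure m n) = g (tpure m n)) -> f =1 g.
Proof.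
move=> fD gD fg; apply: tensor_ind => // [|x y fx fy].
  have f0 : f 0 = 0 by apply: (addrI (f 0)); rewrite -fD !addr0.
  by rewrite f0; apply: (addrI (g 0)); rewrite -gD !addr0.
by rewrite fD gD fx fy.
Qed.

Lemma fg_finType (R : pzRingType) (M : lmodType R) (I : finType) (g : I -> M) :
  (forall x, exists c : I -> R, x = \sum_i c i *: g i) -> finitely_generated M.
Proof.
move=> gen; exists #|I|, (fun i => g (enum_val i)) => x.
have [c ->] := gen x; exists (fun i => c (enum_val i)).
by rewrite (reindex (@enum_val I I))//; exact/onW_bij/enum_val_bij.
Qed.

(** A type alias, so that the action of R through phi can be declared beside the action of S on the
    same group. *)
Definition restr (R S : pzRingType) (phi : {rmorphism R -> S}) (X : lmodType S) :
  Type := X.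

(** * Restriction of scalars and the module S (x)_R M *)

Section BaseChange.
Variables (R S : pzRingType) (phi : {rmorphism R -> S}).

Section Restriction.
Variable X : lmodType S.
Local Notation restr := (restr phi X).

HB.instance Definition _ := GRing.Zmodule.on restr.

Definition restr_scale (r : R) (x : restr) : restr := phi r *: (x : X).

Lemma restr_scaleA a b x : restr_scale a (restr_scale b x) = restr_scale (a * b) x.
Proof. by rewrite /restr_scale scalerA rmorphM. Qed.

Lemma restr_scale1 : left_id 1 restr_scale.
Proof. by move=> x; rewrite /restr_scale rmorph1 scale1r. Qed.

Lemma restr_scaleDr : right_distributive restr_scale +%R.
Proof. by move=> a x y; rewrite /restr_scale scalerDr. Qed.

Lemma restr_scaleDl x : {morph restr_scale^~ x : a b / a + b}.
Proof. by move=> a b; rewrite /restr_scale rmorphD scalerDl. Qed.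

HB.instance Definition _ := GRing.Zmodule_isLmodule.Build R restr
  restr_scaleA restr_scale1 restr_scaleDr restr_scaleDl.

Lemma restrZ (r : R) (x : restr) : r *: x = phi r *: (x : X).
Proof. by []. Qed.

End Restriction.

Lemma restr_map_linear (X Y : lmodType S) (f : {linear X -> Y}) :
  linear (f : restr phi X -> restr phi Y).
Proof. by move=> r x y; rewrite !restrZ linearP. Qed.

Definition restr_map (X Y : lmodType S) (f : {linear X -> Y}) :
  {linear restr phi X -> restr phi Y} := Linear (restr_map_linear f).

Definition ract (s : S) (r : R) : S := s * phi r.

Section Extension.
Variable M : lmodType R.

Definition extn : Type := tensor ract (@GRing.scale R M).
HB.instance Definition _ := GRing.Zmodule.on extn.

Definition extp (s : S) (x : M) : extn := tpure s x.

Lemma extpDl x : {morph extp^~ x : s t / s + t}.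
Proof. by case: (tpure_balanced ract (@GRing.scale R M)). Qed.

Lemma extpDr s : {morph extp s : x y / x + y}.
Proof. by case: (tpure_balanced ract (@GRing.scale R M)). Qed.

Lemma extp0r s : extp s 0 = 0.
Proof. by apply: (addrI (extp s 0)); rewrite -extpDr !addr0. Qed.

Lemma extpBr s x y : extp s (x - y) = extp s x - extp s y.
Proof. by apply: (addIr (extp s y)); rewrite -extpDr !subrK. Qed.

Lemma extpM s r x : extp (s * phi r) x = extp s (r *: x).
Proof. by case: (tpure_balanced ract (@GRing.scale R M)) => _ _; exact. Qed.

Lemma extn_mul_balanced (s : S) :
  balanced ract (@GRing.scale R M) (fun t x => extp (s * t) x).
Proof.
split=> [x t u|t x y|t r x].
- by rewrite mulrDr extpDl.
- exact: extpDr.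
- by rewrite /ract mulrA extpM.
Qed.

Definition extn_scale (s : S) (t : extn) : extn := tlift (fun u x => extp (s * u) x) t.

Lemma extn_scale_pure s t x : extn_scale s (extp t x) = extp (s * t) x.
Proof. exact: tlift_pure (extn_mul_balanced s). Qed.

Lemma extn_scaleDr : right_distributive extn_scale +%R.
Proof. by move=> s; exact: tliftD (extn_mul_balanced s). Qed.

Lemma extn_scaleDl t : {morph extn_scale^~ t : a b / a + b}.
Proof.
move=> a b; elim/tensor_ind: t => [|x y xE yE|u x].
- by rewrite /extn_scale !tlift_tzero ?addr0//; exact: extn_mul_balanced.
- by rewrite !extn_scaleDr xE yE addrACA.
- by rewrite !extn_scale_pure mulrDl extpDl.
Qed.

Lemma extn_scale1 : left_id 1 extn_scale.
Proof.
apply: tensor_ext => //; first exact: extn_scaleDr.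
by move=> s x; rewrite extn_scale_pure mul1r.
Qed.

Lemma extn_scaleA a b t : extn_scale a (extn_scale b t) = extn_scale (a * b) t.
Proof.
move: t; apply: tensor_ext; try by move=> x y; rewrite ?extn_scaleDr.
by move=> s x; rewrite !extn_scale_pure mulrA.
Qed.

HB.instance Definition _ := GRing.Zmodule_isLmodule.Build S extn
  extn_scaleA extn_scale1 extn_scaleDr extn_scaleDl.

Lemma extnZ (s t : S) x : s *: extp t x = extp (s * t) x.
Proof. exact: extn_scale_pure. Qed.

Lemma extn_ext (X : lmodType S) (f g : {linear extn -> X}) :
  (forall s x, f (extp s x) = g (extp s x)) -> f =1 g.
Proof. by move=> fg; apply: tensor_ext fg => x y; rewrite raddfD. Qed.

Variables (X : lmodType S) (f : S -> M -> X).
Hypothesis bf : balanced ract (@GRing.scale R M) f.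
Hypothesis fM : forall s t x, f (s * t) x = s *: f t x.

Lemma ext_lift_linear : linear (tlift f : extn -> X).
Proof.
move=> s t u; rewrite tliftD//; congr (_ + _); move: t.
apply: tensor_ext => [x y|x y|t x]; rewrite ?scalerDr ?tliftD ?scalerDr//.
by rewrite [_ *: _]extnZ !tlift_pure// fM.
Qed.

Definition ext_lift : {linear extn -> X} := Linear ext_lift_linear.

Lemma ext_lift_pure s x : ext_lift (extp s x) = f s x.
Proof. exact: tlift_pure. Qed.

End Extension.
End BaseChange.

Arguments extp {R S} phi {M} s x.
Arguments ext_lift : simpl never.
Arguments extpDl {R S} phi {M} x.
Arguments extpDr {R S} phi {M} s.
Arguments extp0r {R S} phi {M} s.
Arguments restrZ {R S} phi {X}.
Arguments extpBr {R S} phi {M} s x y.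

(** * Functoriality, adjunction and flatness of S (x)_R - *)

Section ExtensionFunctor.
Variables (R S : pzRingType) (phi : {rmorphism R -> S}).
Local Notation ext := (extn phi).
Local Notation res := (restr phi).

Section Map.
Variables (M N : lmodType R) (f : {linear M -> N}).

Lemma ext_map_balanced :
  balanced (ract phi) (@GRing.scale R M) (fun s x => extp phi s (f x)).
Proof.
split=> [x s t|s x y|s r x]; rewrite ?raddfD ?extpDl ?extpDr//.
by rewrite linearZ extpM.
Qed.

Lemma ext_map_mul s t x : extp phi (s * t) (f x) = s *: extp phi t (f x).
Proof. by rewrite extnZ. Qed.

Definition ext_map : {linear ext M -> ext N} := ext_lift ext_map_balanced ext_map_mul.

Lemma ext_mapE s x : ext_map (extp phi s x) = extp phi s (f x).
Proof. exact: ext_lift_pure. Qed.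

End Map.
Arguments ext_map : simpl never.

Lemma extn_unit_linear (M : lmodType R) :
  linear (fun x : M => extp phi 1 x : res (ext M)).
Proof. by move=> r x y; rewrite restrZ extnZ extpDr -extpM mul1r mulr1. Qed.

Definition ext_unit (M : lmodType R) : {linear M -> res (ext M)} :=
  Linear (extn_unit_linear (M := M)).

Section Adjoint.
Variables (M : lmodType R) (X : lmodType S) (h : {linear M -> res X}).

Lemma ext_adj_balanced :
  balanced (ract phi) (@GRing.scale R M) (fun s x => s *: (h x : X)).
Proof.
split=> [x s t|s x y|s r x]; rewrite ?scalerDl ?raddfD ?scalerDr//.
by rewrite linearZZ restrZ scalerA.
Qed.

Lemma ext_adj_mul s t x : (s * t) *: (h x : X) = s *: (t *: (h x : X)).
Proof. by rewrite scalerA. Qed.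

Definition ext_adj : {linear ext M -> X} := ext_lift ext_adj_balanced ext_adj_mul.

Lemma ext_adjE s x : ext_adj (extp phi s x) = s *: (h x : X).
Proof. exact: ext_lift_pure. Qed.

End Adjoint.
Arguments ext_adj : simpl never.

(** Extension is left adjoint to restriction, and restriction preserves surjections. *)
Lemma projective_ext (P : lmodType R) : projective P -> projective (ext P).
Proof.
move=> pP X Y g f sg.
have [h gh] := pP (res X) (res Y) (restr_map phi g) (restr_map phi f \o ext_unit P) sg.
exists (ext_adj h); apply: (extn_ext (f := g \o ext_adj h) (g := f)) => s x.
have {}gh : g (h x : X) = f (extp phi 1 x) := gh x.
by rewrite -[LHS]/(g (ext_adj h (extp phi s x))) ext_adjE linearZZ gh -linearZZ extnZ mulr1.
Qed.

Lemma fg_ext (M : lmodType R) : finitely_generated M -> finitely_generated (ext M).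
Proof.
move=> [n [g gen]]; exists n, (fun i => extp phi 1 (g i)).
elim/tensor_ind => [|x y [c ->] [d ->]|s x].
- by exists (fun=> 0); rewrite big1 // => i _; rewrite scale0r.
- exists (fun i => c i + d i); rewrite -big_split.
  by apply: eq_bigr => i _; rewrite scalerDl.
- have [c xE] := gen x; exists (fun i => s * phi (c i)).
  rewrite -[LHS]/(extp phi s x) xE (big_morph _ (extpDr phi s) (extp0r phi s)).
  by apply: eq_bigr => i _; rewrite extnZ mulr1 extpM.
Qed.

Section Flat.
Hypothesis flat : forall (X Y Z : lmodType R) (f : {linear X -> Y})
  (g : {linear Y -> Z}), exact f g -> exact (ext_map f) (ext_map g).

Let Z : lmodType R := 'rV[R]_0.

(** Flatness is given as preservation of exactness at a middle term; here it is applied to 0 -> M ->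
    N. *)
Lemma ext_inj (M N : lmodType R) (f : {linear M -> N}) :
  injective f -> injective (ext_map f).
Proof.
move=> fi; have /flat/exactP[_ e] : exact (@GRing.null_fun Z M) f.
  apply/exactP; split=> [x|y fy]; first exact: raddf0.
  by exists 0; apply: fi; rewrite fy raddf0.
apply: raddf_inj => x /e[y <-].
apply: (extn_ext (f := ext_map (@GRing.null_fun Z M)) (g := @GRing.null_fun _ _)).
by move=> s z; rewrite ext_mapE extp0r.
Qed.

Lemma ext_surj (M N : lmodType R) (f : {linear M -> N}) :
  (forall y, exists x, f x = y) -> forall y, exists x, ext_map f x = y.
Proof.
move=> fs; elim/tensor_ind => [|x y [x' <-] [y' <-]|s y].
- by exists 0; rewrite raddf0.
- by exists (x' + y'); rewrite raddfD.
- by have [x <-] := fs y; exists (extp phi s x); rewrite ext_mapE.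
Qed.

Lemma pd_le_ext n (M : lmodType R) : pd_le n M -> pd_le n (ext M).
Proof.
elim: n M => [|n IH] M; first exact: projective_ext.
move=> [P [K [i [e [pP ii ie se pdK]]]]].
exists (ext P), (ext K), (ext_map i), (ext_map e); split.
- exact: projective_ext.
- exact: ext_inj.
- exact: flat.
- exact: ext_surj.
- exact: IH.
Qed.

End Flat.

(** * Separable extensions *)

Section Separable.
Variables (s : seq (S * S)).
Hypothesis s1 : \sum_(q <- s) q.1 * q.2 = 1.
(* Centrality of s in S (x)_R S, tested against balanced maps. *)
Hypothesis sC : forall (G : zmodType) (f : S -> S -> G),
  balanced (ract phi) (fun r t => phi r * t) f ->
  forall a, \sum_(q <- s) f (a * q.1) q.2 = \sum_(q <- s) f q.1 (q.2 * a).

Lemma separable_balanced (X : lmodType S) (x : X) :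
  balanced (ract phi) (fun r t => phi r * t)
    (fun t u => extp phi t (u *: x : res X)).
Proof.
split=> [u a b|u a b|u r a]; first exact: extpDl.
- by rewrite scalerDl (extpDr phi u).
- by rewrite /ract -scalerA -(restrZ phi) -extpM.
Qed.

Lemma ext_restr_section_linear (X : lmodType S) :
  linear (fun x : X => \sum_(q <- s) extp phi q.1 (q.2 *: x : res X)).
Proof.
move=> a x y; rewrite scaler_sumr.
under [X in _ = X + _]eq_bigr do rewrite extnZ.
rewrite (sC (separable_balanced x)) -big_split /=.
by apply: eq_bigr => q _; rewrite scalerDr scalerA (extpDr phi).
Qed.

(** The separability element splits the multiplication S (x)_R X -> X by x |-> sum of q.1 (x) q.2 x;
    centrality makes this section S-linear, so X is a direct summand of S (x)_R X. *)
Lemma pd_le_separable n (X : lmodType S) : pd_le n (ext (res X)) -> pd_le n X.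
Proof.
apply: (pd_le_retract (i := Linear (ext_restr_section_linear (X := X)))
                      (r := ext_adj (idfun : {linear res X -> res X}))) => x.
rewrite -[LHS]/(ext_adj _ (\sum_(q <- s) extp phi q.1 (q.2 *: x : res X))).
rewrite linear_sum -[RHS]scale1r -s1 scaler_suml.
by apply: eq_bigr => q _; rewrite ext_adjE scalerA.
Qed.

End Separable.

End ExtensionFunctor.

(** * Coinduced modules *)

Section Coinduction.
Variables (R S : pzRingType) (phi : {rmorphism R -> S}) (X : lmodType R).

(** These maps form Hom_R(S, X), on which S acts by right multiplication of the argument; the
    functor is right adjoint to restriction. *)
Definition is_coind : {pred S -> X} := fun u =>
  `[< {morph u : x y / x + y} /\ forall r s, u (phi r * s) = r *: u s >].

Lemma is_coind_closed : zmod_closed is_coind.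
Proof.
split=> [|u v /asboolP[uD uZ] /asboolP[vD vZ]]; apply/asboolP; split=> [x y|r s].
- exact: (esym (addr0 _)).
- exact: (esym (scaler0 _ _)).
- by rewrite !fctE uD vD opprD addrACA.
- by rewrite !fctE uZ vZ scalerBr.
Qed.

HB.instance Definition _ := GRing.isZmodClosed.Build (S -> X) is_coind is_coind_closed.

Record coind := Coind { coind_val : S -> X; coind_valP : coind_val \in is_coind }.

HB.instance Definition _ := [isSub for coind_val].
HB.instance Definition _ := [Choice of coind by <:].
HB.instance Definition _ := [SubChoice_isSubZmodule of coind by <:].

Lemma coindD (u : coind) : {morph val u : x y / x + y}.
Proof. by have /asboolP[] := coind_valP u. Qed.

Lemma coindZ (u : coind) r s : val u (phi r * s) = r *: val u s.
Proof. by have /asboolP[_] := coind_valP u; exact. Qed.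

Lemma coind_scale_subproof (s : S) (u : coind) :
  (fun t => val u (t * s)) \in is_coind.
Proof.
by apply/asboolP; split=> [x y|r t]; rewrite ?mulrDl ?coindD// -mulrA coindZ.
Qed.

Definition coind_scale s u : coind := Coind (coind_scale_subproof s u).

Lemma coind_scaleA a b u : coind_scale a (coind_scale b u) = coind_scale (a * b) u.
Proof. by apply: val_inj; apply/funext => s /=; rewrite mulrA. Qed.

Lemma coind_scale1 : left_id 1 coind_scale.
Proof. by move=> u; apply: val_inj; apply/funext => s /=; rewrite mulr1. Qed.

Lemma coind_scaleDr : right_distributive coind_scale +%R.
Proof. by move=> a u v; apply: val_inj; apply/funext => s. Qed.

Lemma coind_scaleDl u : {morph coind_scale^~ u : a b / a + b}.
Proof.
by move=> a b; apply: val_inj; apply/funext => s; rewrite /= mulrDr coindD.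
Qed.

HB.instance Definition _ := GRing.Zmodule_isLmodule.Build S coind
  coind_scaleA coind_scale1 coind_scaleDr coind_scaleDl.

Lemma coind_scaleE (s t : S) (u : coind) : val (s *: u) t = val u (t * s).
Proof. by []. Qed.

End Coinduction.

(** * Restriction along an extension with a finite left dual basis *)

Section DualBasis.
Variables (R S : pzRingType) (phi : {rmorphism R -> S}).
Variables (n : nat) (c : 'I_n -> S -> R) (y : 'I_n -> S).
Hypothesis cD : forall i, {morph c i : s t / s + t}.
Hypothesis cM : forall i r s, c i (phi r * s) = r * c i s.
Hypothesis dual_basis : forall s, s = \sum_i phi (c i s) * y i.

Section CoindMap.
Variables (X Y : lmodType R) (g : {linear X -> Y}).

Lemma coind_map_subproof (u : coind phi X) : (g \o val u) \in is_coind phi (X := Y).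
Proof.
by apply/asboolP; split=> [s t|r s]; rewrite /= ?coindD ?raddfD ?coindZ ?linearZZ.
Qed.

Definition coind_map_fun u : coind phi Y := Coind (coind_map_subproof u).

Lemma coind_map_linear : linear coind_map_fun.
Proof.
by move=> s u v; apply: val_inj; apply/funext => t; exact: raddfD.
Qed.

Definition coind_map : {linear coind phi X -> coind phi Y} := Linear coind_map_linear.

(** The dual basis recovers u from its values at the [y i]. Lifting these values by an arbitrary
    set-theoretic section h of g and recombining them with the coefficients [c i] gives a preimage
    that is again R-linear. *)
Lemma coind_map_surj : (forall z, exists x, g x = z) ->
  forall u, exists v, coind_map v = u.
Proof.
move=> /choice[h gh] u.
have vP : (fun s => \sum_i c i s *: h (val u (y i))) \in is_coind phi (X := X).
  apply/asboolP; split=> [s t|r s].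
    by rewrite -big_split; apply: eq_bigr => i _; rewrite cD scalerDl.
  by rewrite scaler_sumr; apply: eq_bigr => i _; rewrite cM scalerA.
exists (Coind vP); apply: val_inj; apply/funext => s /=.
have u0 : val u 0 = 0 by apply: (addrI (val u 0)); rewrite -coindD !addr0.
rewrite linear_sum [in RHS](dual_basis s) (big_morph _ (coindD u) u0).
by apply: eq_bigr => i _; rewrite linearZZ gh coindZ.
Qed.

End CoindMap.

(** Restriction is left adjoint to coinduction, which preserves surjections by the dual basis: the
    transpose of f is lifted, and evaluating the lift at 1 transposes it back. *)
Lemma projective_restr (P : lmodType S) : projective P -> projective (restr phi P).
Proof.
move=> pP X Y g f /surjP sg.
have fP (p : P) : (fun s => f (s *: p)) \in is_coind phi (X := Y).
  apply/asboolP; split=> [s t|r s]; first by rewrite scalerDl raddfD.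
  by rewrite -scalerA -(restrZ phi) linearZZ.
have lf : linear (fun p : P => Coind (fP p) : coind phi Y).
  move=> s p q; apply: val_inj; apply/funext => t /=.
  by rewrite scalerDr raddfD scalerA.
have [h gh] := pP _ _ (coind_map g) (Linear lf) (iffRL (surjP _) (coind_map_surj sg)).
have lh : linear (fun p : restr phi P => val (h p) 1).
  move=> r p q; rewrite restrZ linearP.
  rewrite -[LHS]/(val (phi r *: h p) 1 + val (h q) 1) coind_scaleE.
  by rewrite mul1r -[phi r]mulr1 coindZ.
exists (Linear lh) => p; have /(congr1 (fun u : coind phi Y => val u 1)) /= := gh p.
by rewrite scale1r.
Qed.

Lemma pd_le_restr k (X : lmodType S) : pd_le k X -> pd_le k (restr phi X).
Proof.
elim: k X => [|k IH] X; first exact: projective_restr.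
move=> [P [K [i [e [pP ii ie se pdK]]]]].
exists (restr phi P), (restr phi K), (restr_map phi i), (restr_map phi e); split=> //.
- exact: projective_restr.
- exact: IH.
Qed.

Lemma fg_restr (X : lmodType S) : finitely_generated X -> finitely_generated (restr phi X).
Proof.
move=> [m [g gen]].
apply: (@fg_finType _ _ ('I_m * 'I_n)%type (fun ij => y ij.2 *: g ij.1 : restr phi X)) => x.
have [a ->] := gen x; exists (fun ij => c ij.2 (a ij.1)).
rewrite -(pair_bigA _ (fun i j => c j (a i) *: (y j *: g i : restr phi X))) /=.
apply: eq_bigr => i _; rewrite {1}(dual_basis (a i)) scaler_suml.
by apply: eq_bigr => j _; rewrite restrZ scalerA.
Qed.

End DualBasis.

(** * Descent along a flat extension with a left linear retraction *)

Section LeftSplit.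
Variables (R S : pzRingType) (phi : {rmorphism R -> S}) (p : S -> R).
Hypothesis pD : {morph p : s t / s + t}.
Hypothesis pM : forall r s, p (phi r * s) = r * p s.
Hypothesis p1 : p 1 = 1.

(* R (x)_Z P, obtained by letting the empty type act. *)
Section Induced.
Variable P : zmodType.

Let noact (T : zmodType) (x : T) (e : void) : T := match e with end.
Let lnoact (T : zmodType) (e : void) (x : T) : T := match e with end.

Definition indz : Type := tensor (@noact R) (@lnoact P).
HB.instance Definition _ := GRing.Zmodule.on indz.

Definition indp (r : R) (x : P) : indz := tpure r x.

Lemma indz_balanced (G : zmodType) (f : R -> P -> G) :
  (forall x, {morph f^~ x : a b / a + b}) -> (forall a, {morph f a : x y / x + y}) ->
  balanced (@noact R) (@lnoact P) f.
Proof. by move=> fl fr; split. Qed.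

Lemma indpDl x : {morph indp^~ x : a b / a + b}.
Proof. by case: (tpure_balanced (@noact R) (@lnoact P)). Qed.

Lemma indpDr a : {morph indp a : x y / x + y}.
Proof. by case: (tpure_balanced (@noact R) (@lnoact P)). Qed.

Lemma indz_mul_balanced (r : R) :
  balanced (@noact R) (@lnoact P) (fun a x => indp (r * a) x).
Proof.
by apply: indz_balanced => [x a b|a]; rewrite ?mulrDr ?indpDl//; exact: indpDr.
Qed.

Definition indz_scale (r : R) (t : indz) : indz := tlift (fun a x => indp (r * a) x) t.

Lemma indz_scale_pure r a x : indz_scale r (indp a x) = indp (r * a) x.
Proof. exact: tlift_pure (indz_mul_balanced r). Qed.

Lemma indz_scaleDr : right_distributive indz_scale +%R.
Proof. by move=> r; exact: tliftD (indz_mul_balanced r). Qed.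

Lemma indz_scaleDl t : {morph indz_scale^~ t : a b / a + b}.
Proof.
move=> a b; elim/tensor_ind: t => [|x y xE yE|u x].
- by rewrite /indz_scale !tlift_tzero ?addr0//; exact: indz_mul_balanced.
- by rewrite !indz_scaleDr xE yE addrACA.
- by rewrite !indz_scale_pure mulrDl indpDl.
Qed.

Lemma indz_scale1 : left_id 1 indz_scale.
Proof.
apply: tensor_ext => //; first exact: indz_scaleDr.
by move=> s x; rewrite indz_scale_pure mul1r.
Qed.

Lemma indz_scaleA a b t : indz_scale a (indz_scale b t) = indz_scale (a * b) t.
Proof.
move: t; apply: tensor_ext; try by move=> x y; rewrite ?indz_scaleDr.
by move=> s x; rewrite !indz_scale_pure mulrA.
Qed.

HB.instance Definition _ := GRing.Zmodule_isLmodule.Build R indz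
  indz_scaleA indz_scale1 indz_scaleDr indz_scaleDl.

Lemma indzZ (r a : R) x : r *: indp a x = indp (r * a) x.
Proof. exact: indz_scale_pure. Qed.

(** This is p (x) id under the identification of S (x)_R (R (x)_Z P) with S (x)_Z P. *)
Definition indz_act (s : S) (t : indz) : indz := tlift (fun a x => indp (p (s * phi a)) x) t.

Lemma indz_act_balanced s :
  balanced (@noact R) (@lnoact P) (fun a x => indp (p (s * phi a)) x).
Proof.
apply: indz_balanced => [x a b|a]; last exact: indpDr.
by rewrite rmorphD mulrDr pD indpDl.
Qed.

Lemma indz_act_pure s a x : indz_act s (indp a x) = indp (p (s * phi a)) x.
Proof. exact: tlift_pure (indz_act_balanced s). Qed.

Lemma indz_actDr s : {morph indz_act s : t u / t + u}.
Proof. exact: tliftD (indz_act_balanced s). Qed.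

Lemma indz_actDl t : {morph indz_act^~ t : a b / a + b}.
Proof.
move=> a b; elim/tensor_ind: t => [|x y xE yE|u x].
- by rewrite /indz_act !tlift_tzero ?addr0//; exact: indz_act_balanced.
- by rewrite !indz_actDr xE yE addrACA.
- by rewrite !indz_act_pure mulrDl pD indpDl.
Qed.

Lemma indz_act1 t : indz_act 1 t = t.
Proof.
move: t; apply: tensor_ext => // [|a x]; first exact: indz_actDr.
by rewrite indz_act_pure mul1r -[phi a]mulr1 pM p1 mulr1.
Qed.

Lemma indz_actZ s r t : indz_act (s * phi r) t = indz_act s (r *: t).
Proof.
move: t; apply: tensor_ext => [||a x]; try by move=> x y; rewrite ?scalerDr indz_actDr.
by rewrite indzZ !indz_act_pure rmorphM mulrA.
Qed.

Lemma indz_actM r s t : indz_act (phi r * s) t = r *: indz_act s t.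
Proof.
move: t; apply: tensor_ext => [||a x].
- exact: indz_actDr.
- by move=> x y; rewrite indz_actDr scalerDr.
- by rewrite !indz_act_pure indzZ -mulrA pM.
Qed.

Lemma indz_retract_balanced : balanced (ract phi) (@GRing.scale R indz) indz_act.
Proof.
split=> [t|s|s r t]; [exact: indz_actDl|exact: indz_actDr|exact: indz_actZ].
Qed.

Lemma indz_retract_linear : linear (tlift indz_act : restr phi (extn phi indz) -> indz).
Proof.
have bal := indz_retract_balanced.
move=> r t u; rewrite restrZ tliftD//; congr (_ + _); move: t.
apply: tensor_ext => [x y|x y|s x]; rewrite ?scalerDr ?tliftD ?scalerDr//.
by rewrite [_ *: _ in LHS](extnZ phi (phi r) s) !tlift_pure// indz_actM.
Qed.

Definition indz_retract : {linear restr phi (extn phi indz) -> indz} :=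
  Linear indz_retract_linear.

Lemma indz_retractK t : indz_retract (extp phi 1 t) = t.
Proof. by rewrite -[RHS]indz_act1; exact: tlift_pure indz_retract_balanced. Qed.

End Induced.

Section IndzCounit.
Variable P : lmodType R.

Lemma indz_eval_linear :
  linear (tlift (fun (a : R) (x : P) => a *: x) : indz P -> P).
Proof.
have bal : balanced (fun (a : R) (e : void) => match e with end)
    (fun (e : void) (x : P) => match e with end) (fun a x => a *: x).
  apply: indz_balanced => [x a b|a x y]; [exact: scalerDl|exact: scalerDr].
move=> r t u; rewrite tliftD//; congr (_ + _); move: t.
apply: tensor_ext => [x y|x y|s x]; rewrite ?scalerDr ?tliftD ?scalerDr//.
by rewrite [_ *: _ in LHS](indzZ r s) !tlift_pure// scalerA.
Qed.

(** For projective P the evaluation R (x)_Z P -> P splits, and the retraction available for R (x)_Z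
    P is transported along the splitting. *)
Lemma projective_ext_retract : projective P ->
  exists q : {linear restr phi (extn phi P) -> P}, forall x, q (extp phi 1 x) = x.
Proof.
move=> pP; pose ev := Linear indz_eval_linear.
have evE a x : ev (indp a x) = a *: x.
  apply: tlift_pure; apply: indz_balanced => [y b c|b y z].
    exact: scalerDl.
  exact: scalerDr.
have [|s sK] := projective_section (e := ev) pP.
  by move=> x; exists (indp 1 x); rewrite evE scale1r.
exists (ev \o (indz_retract P \o restr_map phi (ext_map phi s))) => x /=.
by rewrite -[RHS]sK -[s x]indz_retractK; congr (ev (indz_retract P _)); exact: ext_mapE.
Qed.

End IndzCounit.

Hypothesis flat : forall (X Y Z : lmodType R) (f : {linear X -> Y})
  (g : {linear Y -> Z}), exact f g -> exact (ext_map phi f) (ext_map phi g).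

(** Changing a lift x of m by i k changes i (t x) by the same i k. Hence x - i (t x) depends on m
    alone, and it defines a linear section of e although the lifts were chosen arbitrarily. *)
Lemma projective_of_retraction (P K M : lmodType R) (i : {linear K -> P})
    (e : {linear P -> M}) (t : {linear P -> K}) :
  projective P -> exact i e -> (forall y, exists x, e x = y) -> cancel i t ->
  projective M.
Proof.
move=> pP /exactP[ei0 ei1] /choice[s sE] tK.
have eqs x x' : e x = e x' -> x - i (t x) = x' - i (t x').
  move=> xx'; have /ei1[k kE] : e (x - x') = 0 by rewrite linearB xx' subrr.
  have -> : x = i k + x' by rewrite kE subrK.
  by rewrite !linearD tK addrACA subrr add0r.
have ls : linear (fun m => s m - i (t (s m))).
  move=> r m n; have es : e (s (r *: m + n)) = e (r *: s m + s n).
    by rewrite linearP !sE.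
  by rewrite (eqs _ _ es) 2!linearP scalerBr opprD addrACA.
apply: (projective_retract (i := Linear ls) (r := e)) pP => m /=.
by rewrite linearB /= ei0 subr0 sE.
Qed.

(** At n = 0 the kernel K is projective and the extended sequence splits; composing P -> S (x)_R P
    -> S (x)_R K -> K, the last map being the retraction for projectives, gives a left inverse of i.
    For larger n the argument passes to syzygies on both sides. *)
Lemma pd_le_ext_descent n (M : lmodType R) :
  pd_le n.+1 M -> pd_le n (extn phi M) -> pd_le n M.
Proof.
elim: n M => [|n IH] M [P [K [i [e [pP ii ie se pdK]]]]] pdM.
- have eie := flat ie; have [ei0 ei1] := iffLR (exactP _ _) eie.
  have [s sK] := projective_section pdM (ext_surj se).
  have eii := ext_inj flat ii.
  have pick z : exists w, ext_map phi i w = z - s (ext_map phi e z).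
    by apply: ei1; rewrite linearB sK subrr.
  have [t tE] := choice pick.
  have lt : linear t.
    move=> r x y; apply: eii; rewrite linearP !tE !linearP.
    by rewrite addrACA -scalerDr.
  have [q qE] := projective_ext_retract pdK.
  apply: (projective_of_retraction
    (t := q \o (restr_map phi (Linear lt) \o ext_unit phi P)) pP ie se) => k.
  rewrite -[RHS]qE; congr (q _); apply: eii.
  rewrite -[LHS]/(ext_map phi i (t (extp phi 1 (i k)))) tE -ext_mapE ei0.
  by rewrite linear0 subr0.
- exists P, K, i, e; split=> //; apply: IH => //.
  apply: (pd_le_syzygy (i := ext_map phi i) (e := ext_map phi e)) pdM.
  + exact: projective_ext.
  + exact: ext_inj.
  + exact: flat.
  + exact: ext_surj.
Qed.

(** The finite bound k is lowered one step at a time until it reaches n. *)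
Lemma pd_le_ext_inv n k (M : lmodType R) :
  pd_le k M -> pd_le n (extn phi M) -> pd_le n M.
Proof.
move=> pdM pdE; case: (leqP k n) => [kn|/ltnW nk].
  rewrite -(subnK kn); elim: (n - k)%N => // m; exact: pd_leS.
move: pdM; rewrite -(subnKC nk); elim: (k - n)%N => [|m IH]; first by rewrite addn0.
rewrite addnS => pdM; apply: IH; apply: pd_le_ext_descent => //.
by elim: m {pdM} => [|m IHm]; [rewrite addn0|rewrite addnS; exact: pd_leS].
Qed.

End LeftSplit.

(** Isolates the ring-theoretic data that the Galois structure has to provide: a left dual basis (c,
    y), a left linear retraction p and a separability element e. *)
Theorem fin_dim_extension (R S : pzRingType) (phi : {rmorphism R -> S})
    (n : nat) (c : 'I_n -> S -> R) (y : 'I_n -> S) (p : S -> R) (e : seq (S * S)) :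
  faithfully_flat (ract phi) ->
  (forall i, {morph c i : s t / s + t}) ->
  (forall i r s, c i (phi r * s) = r * c i s) ->
  (forall s, s = \sum_i phi (c i s) * y i) ->
  {morph p : s t / s + t} -> (forall r s, p (phi r * s) = r * p s) -> p 1 = 1 ->
  \sum_(q <- e) q.1 * q.2 = 1 ->
  (forall (G : zmodType) (f : S -> S -> G),
    balanced (ract phi) (fun r t => phi r * t) f ->
    forall a, \sum_(q <- e) f (a * q.1) q.2 = \sum_(q <- e) f q.1 (q.2 * a)) ->
  fin_dim R = fin_dim S.
Proof.
move=> ff cD cM db pD pM p1 e1 eC.
have flat (X Y Z : lmodType R) (f : {linear X -> Y}) (g : {linear Y -> Z}) :
  exact f g -> exact (ext_map phi f) (ext_map phi g) := (ff X Y Z f g).1.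
congr (supremum _ _); apply/seteqP; split=> _ [M [fgM fM ->]].
- have [k pdM] := proj_dim_finite fM.
  have eM : proj_dim M = proj_dim (extn phi M).
    apply: eq_proj_dim => m; split; first exact: pd_le_ext.
    exact: (pd_le_ext_inv pD pM p1 flat pdM).
  by exists (extn phi M); split=> //; [exact: fg_ext|rewrite -eM].
- have eM : proj_dim M = proj_dim (restr phi M).
    apply: eq_proj_dim => m; split; first exact: (pd_le_restr cD cM db).
    by move=> /(pd_le_ext flat)/(pd_le_separable e1 eC).
  by exists (restr phi M); split=> //; [exact: (fg_restr db)|rewrite -eM].
Qed.

(** * Semisimple algebras *)

Section SemisimpleIdeals.
Variables (k : fieldType) (H : falgType k).
Hypothesis ssH : semisimple_algebra H.
Implicit Types (L K : {vspace H}).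

Lemma left_idealP L : left_ideal L <-> forall h x, x \in L -> h * x \in L.
Proof.
split=> [/prodvP lL h x|lL]; first exact: lL (memvf h).
by apply/prodvP => h x _; exact: lL.
Qed.

Lemma left_idealD L K : left_ideal L -> left_ideal K -> left_ideal (L + K)%VS.
Proof.
move=> /left_idealP lL /left_idealP lK; apply/left_idealP => h x.
by move=> /memv_addP[u uL [v vK ->]]; rewrite mulrDr memv_add ?lL ?lK.
Qed.

Lemma left_idealI L K : left_ideal L -> left_ideal K -> left_ideal (L :&: K)%VS.
Proof.
move=> /left_idealP lL /left_idealP lK; apply/left_idealP => h x.
by rewrite !memv_cap => /andP[/lL -> /lK ->].
Qed.

(** K has maximal dimension among the left ideals meeting L trivially. A simple summand [I i] not
    contained in L + K would meet it in 0 and could be added to K. *)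
Lemma left_ideal_complement L : left_ideal L ->
  exists K, [/\ left_ideal K, (L :&: K = 0)%VS & (L + K = {:H})%VS].
Proof.
move=> lL; have [n [I [simI _ sumI]]] := ssH.
pose disj m := `[< exists K, [/\ left_ideal K, (L :&: K = 0)%VS & \dim K = m] >].
have disj0 : exists m, disj m.
  exists 0%N; apply/asboolP; exists 0%VS; split; last exact: dimv0.
    by apply/left_idealP => h x; rewrite !memv0 => /eqP->; rewrite mulr0.
  exact: capv0.
have disjB m : disj m -> (m <= \dim {:H})%N.
  by move=> /asboolP[K [_ _ <-]]; exact: dimvS (subvf K).
have [m /asboolP[K [lK LK dK]] maxK] := ex_maxnP disj0 disjB.
exists K; split=> //; apply/eqP; rewrite eqEsubv subvf -sumI.
apply/subv_sumP => i _; have [lI I0 simple_I] := simI i.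
have lJ : left_ideal (I i :&: (L + K))%VS.
  by apply: left_idealI => //; exact: left_idealD.
have [J0|<-] := simple_I _ lJ (capvSl _ _); last exact: capvSr.
have KI0 : (K :&: I i = 0)%VS.
  by apply/eqP; rewrite -subv0 -J0 capvC capvS// addvSr.
suff /maxK : disj (\dim (K + I i)%VS).
  by rewrite dimv_disjoint_sum// -dK -{2}[\dim K]addn0 leq_add2l leqn0 dimv_eq0 (negbTE I0).
apply/asboolP; exists (K + I i)%VS; split=> //; first exact: left_idealD.
apply/eqP; rewrite -subv0; apply/subvP => x.
rewrite memv_cap => /andP[xL /memv_addP[u uK [v vI xE]]].
have v0 : v = 0.
  apply/eqP; rewrite -memv0 -J0 memv_cap vI /=.
  have -> : v = x + - u by rewrite xE addrAC subrr add0r.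
  by rewrite memv_add// memvN.
by rewrite -LK memv_cap xL xE v0 addr0.
Qed.

(** With K a complement of H x and 1 = y x + f, f in K, the element x - x y x = x f lies both in H x
    and in K. *)
Lemma von_neumann_regular (x : H) : exists y, x = x * y * x.
Proof.
have lL : left_ideal ({:H} * <[x]>)%VS.
  by rewrite /left_ideal prodvA prodvSl// subvf.
have [K [/left_idealP lK LK sumLK]] := left_ideal_complement lL.
have : 1 \in ({:H} * <[x]> + K)%VS by rewrite sumLK memvf.
move=> /memv_addP[e eL [f fK oneE]].
have [y eE] : exists y, e = y * x.
  by have [y _ ->] := memv_cosetP eL; exists y.
exists y; apply/eqP; rewrite -subr_eq0 -memv0 -LK memv_cap -mulrA -eE.
have xf : x - x * e = x * f by rewrite -{1}[x]mulr1 oneE mulrDr addrAC subrr add0r.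
rewrite {2}xf lK// andbT eE mulrA -{1}[x]mul1r -mulrBl.
exact: memv_mul (memvf _) (memv_line x).
Qed.

(* A left unit e for finitely many elements extends to one more element x as
   e + z y (1 - e), where z = x - e x = z y z. *)
Lemma right_ideal_left_unit (I : {vspace H}) :
  (forall x h, x \in I -> x * h \in I) ->
  exists2 e, e \in I & forall x, x \in I -> e * x = x.
Proof.
move=> rI.
have fin (s : seq H) : {subset s <= I} ->
    exists2 e, e \in I & forall x, x \in s -> e * x = x.
  elim: s => [_|x s IH sI]; first by exists 0 => //; exact: mem0v.
  have [|e eI eE] := IH; first by move=> y ys; rewrite sI// inE ys orbT.
  have xI : x \in I by rewrite sI ?mem_head.
  pose z := x - e * x; have [y zE] := von_neumann_regular z.
  have zI : z \in I by rewrite memvB// rI.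
  exists (e + z * y * (1 - e)); first by rewrite memvD// !rI.
  move=> u; rewrite inE => /orP[/eqP->|us].
    by rewrite mulrDl -mulrA [(1 - e) * _]mulrBl mul1r -/z -zE addrC subrK.
  by rewrite mulrDl -mulrA [(1 - e) * _]mulrBl mul1r eE// subrr mulr0 addr0.
have [|e eI eE] := fin (vbasis I); first by move=> x; exact: vbasis_mem.
exists e => // x /coord_vbasis ->; rewrite mulr_sumr; apply: eq_bigr => i _.
by rewrite -scalerAr eE// mem_nth ?size_tuple.
Qed.

End SemisimpleIdeals.

(** * Weak Hopf algebras *)

Section KLinear.
Variable k : fieldType.
Implicit Types (U V W M N G : lmodType k).

(** A predicate on bare functions, because Sweedler expressions are written in place and not
    bundled; scalar values are read in [k^o]. *)
Definition lin U V (f : U -> V) : Prop :=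
  forall c x y, f (c *: x + y) = c *: f x + f y.

Definition bil M N G (F : M -> N -> G) : Prop :=
  (forall y, lin (fun x => F x y)) /\ (forall x, lin (fun y => F x y)).

Definition tril M N U G (F : M -> N -> U -> G) : Prop :=
  [/\ forall y z, lin (fun x => F x y z), forall x z, lin (fun y => F x y z)
    & forall x y, lin (fun z => F x y z)].

Lemma linD U V (f : U -> V) : lin f -> {morph f : x y / x + y}.
Proof. by move=> lf x y; have := lf 1 x y; rewrite !scale1r. Qed.

Lemma lin0 U V (f : U -> V) : lin f -> f 0 = 0.
Proof. by move=> /linD fD; apply: (addrI (f 0)); rewrite -fD !addr0. Qed.

Lemma linZ U V (f : U -> V) c x : lin f -> f (c *: x) = c *: f x.
Proof. by move=> lf; have := lf c x 0; rewrite (lin0 lf) !addr0. Qed.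

Lemma lin_sum U V (f : U -> V) I (r : seq I) (g : I -> U) :
  lin f -> f (\sum_(i <- r) g i) = \sum_(i <- r) f (g i).
Proof. by move=> lf; rewrite (big_morph f (linD lf) (lin0 lf)). Qed.

Lemma bil_kbalanced M N G (F : M -> N -> G) : bil F -> kbalanced F.
Proof.
case=> Fl Fr; split=> [y a b|x a b|x c y].
- exact: linD (Fl y) a b.
- exact: linD (Fr x) a b.
- by rewrite (linZ c x (Fl y)) (linZ c y (Fr x)).
Qed.

Lemma klift_kpure M N G (F : M -> N -> G) x y : bil F -> klift F (x ⊗ y) = F x y.
Proof. by move=> /bil_kbalanced; exact: tlift_pure. Qed.

Lemma eq_klift M N (G : zmodType) (F F' : M -> N -> G) t :
  (forall x y, F x y = F' x y) -> klift F t = klift F' t.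
Proof. by move=> e; apply: eq_bigr => p _; exact: e. Qed.

Lemma lin_klift M N G G' (L : G -> G') (F : M -> N -> G) t :
  lin L -> L (klift F t) = klift (fun x y => L (F x y)) t.
Proof. exact: lin_sum. Qed.

(** Each [klift] is a finite sum over a fixed representative, so this is an exchange of finite
    sums. *)
Lemma klift_exchange M N M' N' (G : zmodType) (F : M -> N -> M' -> N' -> G) t s :
  klift (fun x y => klift (fun u v => F x y u v) s) t =
  klift (fun u v => klift (fun x y => F x y u v) t) s.
Proof. exact: exchange_big. Qed.

Lemma klift_id M N (t : (M ⊗ N)%type) : klift (@kpure _ _ _) t = t.
Proof. by rewrite [RHS]tensor_sum. Qed.

Lemma lin_id U : lin (fun x : U => x).
Proof. by []. Qed.

Lemma lin_map U V W (L : {linear V -> W}) (f : U -> V) :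
  lin f -> lin (fun x => L (f x)).
Proof. by move=> lf c x y; rewrite lf linearP. Qed.

Lemma lin_scalar U V (L : {scalar V}) (f : U -> V) :
  lin f -> lin (fun x => L (f x) : k^o).
Proof. by move=> lf c x y; rewrite lf linearP. Qed.

Lemma lin_scale U V c (f : U -> V) : lin f -> lin (fun x => c *: f x).
Proof. by move=> lf a x y; rewrite lf scalerDr !scalerA mulrC. Qed.

Lemma lin_scalel U V (f : U -> k^o) (v : V) : lin f -> lin (fun x => (f x : k) *: v).
Proof. by move=> lf a x y; rewrite lf scalerDl scalerA. Qed.

Lemma lin_mull (A : algType k) U (a : A) (f : U -> A) : lin f -> lin (fun x => a * f x).
Proof. by move=> lf c x y; rewrite lf mulrDr scalerAr. Qed.

Lemma lin_mulr (A : algType k) U (a : A) (f : U -> A) : lin f -> lin (fun x => f x * a).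
Proof. by move=> lf c x y; rewrite lf mulrDl scalerAl. Qed.

Lemma lin_kmull U (a : k) (f : U -> k^o) : lin f -> lin (fun x => a * (f x : k) : k^o).
Proof. exact: (@lin_mull k^o). Qed.

Lemma lin_kmulr U (a : k) (f : U -> k^o) : lin f -> lin (fun x => (f x : k) * a : k^o).
Proof. exact: (@lin_mulr k^o). Qed.

Lemma bil_kpure M N : bil (fun (x : M) (y : N) => x ⊗ y).
Proof.
have [pl pr pb] := tpure_balanced (fun (m : M) (c : k) => c *: m) (@GRing.scale k N).
have Z c (x : M) (y : N) : c *: (x ⊗ y) = (c *: x) ⊗ y.
  apply: tensorP => G f bf; rewrite -!/(klift _ _) klift_scale//.
  by rewrite /klift !tlift_pure//; exact: kbalancedZ.
split=> [y|x] c a b; rewrite /kpure; first by rewrite pl -!/(kpure _ _) Z.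
by rewrite pr -!/(kpure _ _) Z /kpure pb.
Qed.

Lemma lin_kpurel U M N (f : U -> M) (y : N) : lin f -> lin (fun x => f x ⊗ y).
Proof. by move=> lf c u v; rewrite lf (bil_kpure M N).1. Qed.

Lemma lin_kpurer U M N (f : U -> N) (x : M) : lin f -> lin (fun y => x ⊗ f y).
Proof. by move=> lf c u v; rewrite lf (bil_kpure M N).2. Qed.

Lemma lin_klift_arg U M N G (F : M -> N -> G) (f : U -> (M ⊗ N)%type) :
  bil F -> lin f -> lin (fun x => klift F (f x)).
Proof.
move=> bF lf c u v; have kF := bil_kbalanced bF.
rewrite lf /klift tliftD// -!/(klift _ _) klift_scale//; congr (_ + _).
rewrite (lin_klift _ _ (lin_scale c (lin_id (U := G)))).
by apply: eq_klift => x y; rewrite (linZ c x (bF.1 y)).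
Qed.

Lemma lin_klift_body U M N G (F : U -> M -> N -> G) t :
  (forall x y, lin (fun u => F u x y)) -> lin (fun u => klift (fun x y => F u x y) t).
Proof.
move=> lF c u v; rewrite (lin_klift _ _ (lin_scale c (lin_id (U := G)))).
by rewrite /klift /tlift /tsum -big_split; apply: eq_bigr => p _; exact: lF.
Qed.

Lemma lin_big U V I (r : seq I) (F : U -> I -> V) :
  (forall i, lin (fun u => F u i)) -> lin (fun u => \sum_(i <- r) F u i).
Proof.
move=> lF c u v; rewrite scaler_sumr -big_split; apply: eq_bigr => i _; exact: lF.
Qed.

Lemma lin_bil1 U M N G (F : M -> N -> G) (f : U -> M) y :
  bil F -> lin f -> lin (fun x => F (f x) y).
Proof. by move=> [bF _] lf c u v; rewrite lf bF. Qed.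

Lemma lin_bil2 U M N G (F : M -> N -> G) (f : U -> N) x :
  bil F -> lin f -> lin (fun y => F x (f y)).
Proof. by move=> [_ bF] lf c u v; rewrite lf bF. Qed.

Lemma lin_lin U V G (g : V -> G) (f : U -> V) : lin g -> lin f -> lin (fun x => g (f x)).
Proof. by move=> lg lf c u v; rewrite lf lg. Qed.

Lemma kmul_klift (A H : algType k) (G : lmodType k) (F : A -> H -> G) s t :
  bil F -> klift F (kmul s t) =
    klift (fun a h => klift (fun b l => F (a * b) (h * l)) t) s.
Proof.
move=> bF; have lF : lin (klift F).
  exact: (lin_klift_arg (f := fun t => t)).
rewrite /kmul (lin_klift _ _ lF); apply: eq_klift => a h.
by rewrite (lin_klift _ _ lF); apply: eq_klift => b l; rewrite klift_kpure.
Qed.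

End KLinear.

(* Exactly one argument of each operation may depend on the variable, so the
   first alternative that fits determines where to recurse. *)
Ltac lin :=
  cbv beta;
  lazymatch goal with
  | |- bil _ => split=> ?; lin
  | |- tril _ => split=> ? ?; lin
  | |- forall _, _ => move=> ?; lin
  | |- lin (fun x => @klift _ _ _ _ (@?F x) (@?t x)) =>
      first [ refine (lin_klift_arg (f := t) _ _); lin | refine (lin_klift_body _ _); lin ]
  | |- lin (fun x => @kpure _ _ _ (@?f x) (@?g x)) =>
      first [ refine (lin_kpurel (f := f) _ _); lin | refine (lin_kpurer (f := g) _ _); lin ]
  | |- lin (fun x => @GRing.scale _ _ (@?f x) (@?g x)) =>
      first [ refine (lin_scale _ (f := g) _); lin | refine (lin_scalel (f := f) _ _); lin ]
  | |- lin (fun x => @GRing.mul _ (@?f x) (@?g x)) =>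
      first [ refine (lin_kmull _ (f := g) _); lin | refine (lin_kmulr _ (f := f) _); lin
            | refine (lin_mull _ (f := g) _); lin | refine (lin_mulr _ (f := f) _); lin ]
  | |- lin (fun x => @GRing.Linear.sort _ _ _ _ _ (@?f x)) =>
      first [ refine (lin_map _ (f := f) _); lin | refine (lin_scalar _ (f := f) _); lin ]
  | |- lin (fun x => \sum_(i <- _) (@?F x i)) =>
      refine (lin_big _ _); lin
  | |- lin (fun _ => _) =>
      first [exact: lin_id |
      match goal with
      | hf : _ |- _ => solve [apply: hf]
      | hF : bil ?F |- lin (fun x => ?F (@?f x) _) => refine (lin_bil1 (f := f) _ hF _); lin
      | hF : bil ?F |- lin (fun x => ?F _ (@?f x)) => refine (lin_bil2 (f := f) _ hF _); lin
      | hF : forall y z, lin (fun x => ?F x y z) |- lin (fun x => ?F (@?f x) _ _) =>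
          refine (lin_lin (f := f) (hF _ _) _); lin
      | hF : forall x z, lin (fun y => ?F x y z) |- lin (fun x => ?F _ (@?f x) _) =>
          refine (lin_lin (f := f) (hF _ _) _); lin
      | hF : forall x y, lin (fun z => ?F x y z) |- lin (fun x => ?F _ _ (@?f x)) =>
          refine (lin_lin (f := f) (hF _ _) _); lin
      | hg : lin ?g |- lin (fun x => ?g (@?f x)) => refine (lin_lin (f := f) hg _); lin
      end]
  | |- lin ?f => change (lin (fun x => f x)); lin
  end.

(** Converts an axiom stated as an equality in (M (x) N) (x) U, such as coassociativity, into an
    identity for every trilinear F. *)
Lemma tril_lift (k : fieldType) (M N U G : lmodType k) (F : M -> N -> U -> G) :
  tril F ->
  exists2 L : ((M ⊗ N) ⊗ U)%type -> G, lin L & forall x y z, L ((x ⊗ y) ⊗ z) = F x y z.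
Proof.
move=> [F1 F2 F3]; have bF z : bil (fun x y => F x y z) by [].
have bL : bil (fun (p : (M ⊗ N)%type) z => klift (fun x y => F x y z) p) by lin.
exists (klift (fun p z => klift (fun x y => F x y z) p)); last first.
  by move=> x y z; rewrite !klift_kpure.
exact: (lin_klift_arg bL (lin_id (U := _))).
Qed.

Section Sweedler.
Variables (k : fieldType) (H : algType k) (C : weakHopf H).
Implicit Types (G : lmodType k) (g h l : H).
Local Notation Δ := (comul C).

Lemma comul_assoc G (F : H -> H -> H -> G) h : tril F ->
  Σ[x, y <- Δ h] Σ[u, v <- Δ x] F u v y = Σ[x, y <- Δ h] Σ[u, v <- Δ y] F x u v.
Proof.
move=> /tril_lift[L lL LE]; have := congr1 L (comulA C h); rewrite !(lin_klift _ _ lL).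
under eq_klift => x y.
  rewrite (lin_klift _ _ lL).
  under eq_klift => u v do rewrite LE.
  over.
move=> ->; apply: eq_klift => x y; rewrite (lin_klift _ _ lL).
by apply: eq_klift => u v; rewrite LE.
Qed.

End Sweedler.

Arguments comul_assoc {k H C G F} h _.

Section KliftPush.
Variable k : fieldType.
Implicit Types (M N G : lmodType k).

Lemma klift_mull (A : algType k) M N (F : M -> N -> A) t a :
  a * klift F t = klift (fun x y => a * F x y) t.
Proof. exact: (lin_klift _ _ (lin_mull a (lin_id (U := A)))). Qed.

Lemma klift_mulr (A : algType k) M N (F : M -> N -> A) t a :
  klift F t * a = klift (fun x y => F x y * a) t.
Proof. exact: (lin_klift _ _ (lin_mulr a (lin_id (U := A)))). Qed.

Lemma klift_scalel M N G (F : M -> N -> k^o) t (v : G) :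
  (klift F t : k) *: v = klift (fun x y => (F x y : k) *: v) t.
Proof. exact: (lin_klift _ _ (lin_scalel v (lin_id (U := k^o)))). Qed.

Lemma klift_scaler M N G (F : M -> N -> G) t c :
  c *: klift F t = klift (fun x y => c *: F x y) t.
Proof. exact: (lin_klift _ _ (lin_scale c (lin_id (U := G)))). Qed.

Lemma klift_scalar M N G (L : {scalar G}) (F : M -> N -> G) t :
  L (klift F t) = klift (fun x y => L (F x y) : k^o) t.
Proof. exact: (lin_klift _ _ (lin_scalar L (lin_id (U := G)))). Qed.

Lemma klift_sum M N G I (r : seq I) (F : I -> M -> N -> G) t :
  klift (fun x y => \sum_(i <- r) F i x y) t = \sum_(i <- r) klift (F i) t.
Proof. exact: exchange_big. Qed.

End KliftPush.

(** * Counital maps εt and εs *)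

Section WeakHopfIdentities.
Variables (k : fieldType) (H : algType k) (C : weakHopf H).
Implicit Types (G : lmodType k) (g h l : H).
Local Notation Δ := (comul C).
Local Notation ε := (counit C).
Local Notation εt := (eps_t C).
Local Notation εs := (eps_s C).

Lemma comul_counitl G (F : H -> G) h : lin F -> Σ[x, y <- Δ h] ε x *: F y = F h.
Proof.
move=> lF; rewrite -[in RHS](counitL C h) (lin_klift _ _ lF).
by apply: eq_klift => x y; rewrite (linZ _ _ lF).
Qed.

Lemma comul_counitr G (F : H -> G) h : lin F -> Σ[x, y <- Δ h] ε y *: F x = F h.
Proof.
move=> lF; rewrite -[in RHS](counitR C h) (lin_klift _ _ lF).
by apply: eq_klift => x y; rewrite (linZ _ _ lF).
Qed.

Lemma comul_mul G (F : H -> H -> G) h l : bil F ->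
  Σ[x, y <- Δ (h * l)] F x y = Σ[x, y <- Δ h] Σ[u, v <- Δ l] F (x * u) (y * v).
Proof. by move=> bF; rewrite comulM kmul_klift. Qed.

Lemma comul1_l G (F : H -> H -> H -> G) : tril F ->
  Σ[x, y <- Δ 1] Σ[u, v <- Δ y] F x u v =
  Σ[x, y <- Δ 1] Σ[u, v <- Δ 1] F x (y * u) v.
Proof.
move=> tF; have [L lL LE] := tril_lift tF; rewrite -comul_assoc//.
have := congr1 L (comul1L C); rewrite !(lin_klift _ _ lL).
under eq_klift => x y.
  rewrite (lin_klift _ _ lL).
  under eq_klift => u v do rewrite LE.
  over.
move=> ->; apply: eq_klift => x y; rewrite (lin_klift _ _ lL).
by apply: eq_klift => u v; rewrite LE.
Qed.

Lemma comul1_r G (F : H -> H -> H -> G) : tril F ->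
  Σ[x, y <- Δ 1] Σ[u, v <- Δ y] F x u v =
  Σ[x, y <- Δ 1] Σ[u, v <- Δ 1] F x (u * y) v.
Proof.
move=> tF; have [L lL LE] := tril_lift tF; rewrite comul1_l//.
have := congr1 L (etrans (esym (comul1L C)) (comul1R C)); rewrite !(lin_klift _ _ lL).
under eq_klift => x y.
  rewrite (lin_klift _ _ lL).
  under eq_klift => u v do rewrite LE.
  over.
move=> ->; apply: eq_klift => x y; rewrite (lin_klift _ _ lL).
by apply: eq_klift => u v; rewrite LE.
Qed.

(** Both products are Δ^2(1) with its first leg contracted by ε(- l) and its last by ε(h -); the two
    factorizations of Δ^2(1) give the two orders in the middle leg. *)
Lemma eps_t_comm h l : εt l * εs h = εs h * εt l.
Proof.
pose F x m y := (ε (x * l) * ε (h * y)) *: m : H.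
have tF : tril F by rewrite /F; lin.
transitivity (Σ[x, y <- Δ 1] Σ[u, v <- Δ 1] F x (y * u) v).
  rewrite klift_mulr; apply: eq_klift => x y.
  by rewrite klift_mull; apply: eq_klift => u v; rewrite -scalerAl -scalerAr scalerA.
rewrite -comul1_l// comul1_r// klift_mull; apply: eq_klift => x y.
rewrite klift_mulr; apply: eq_klift => u v.
by rewrite -scalerAl -scalerAr scalerA /F [ε _ * _]mulrC.
Qed.

Lemma eps_tE G (F : H -> G) h : lin F -> F (εt h) = Σ[x, y <- Δ 1] ε (x * h) *: F y.
Proof.
by move=> lF; rewrite (lin_klift _ _ lF); apply: eq_klift => x y; rewrite linZ.
Qed.

Lemma eps_sE G (F : H -> G) h : lin F -> F (εs h) = Σ[x, y <- Δ 1] ε (h * y) *: F x.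
Proof.
by move=> lF; rewrite (lin_klift _ _ lF); apply: eq_klift => x y; rewrite linZ.
Qed.

Lemma lin_comul G (F : H -> H -> G) : bil F -> lin (fun h => Σ[x, y <- Δ h] F x y).
Proof. by move=> bF; lin. Qed.

Lemma comul_eps_t_1 G (F : H -> H -> G) h : bil F ->
  Σ[x, y <- Δ (εt h)] F x y =
  Σ[x, y <- Δ 1] Σ[u, v <- Δ y] ε (x * h) *: F u v.
Proof.
move=> bF; rewrite (eps_tE _ (lin_comul bF)).
by apply: eq_klift => x y; rewrite klift_scaler.
Qed.

(** Contracting the first leg of Δ^2(1) with ε(- h) turns its two factorizations into two
    descriptions of Δ on H_t, by left and by right multiplication on the first leg. Contracting the
    last leg does the same for H_s and the second leg. *)
Lemma comul_eps_t G (F : H -> H -> G) h : bil F ->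
  Σ[x, y <- Δ (εt h)] F x y = Σ[x, y <- Δ 1] F (εt h * x) y.
Proof.
move=> bF; rewrite comul_eps_t_1// (comul1_l (F := fun x u v => _)); last by lin.
rewrite klift_exchange; apply: eq_klift => u v.
by rewrite (eps_tE (F := fun z => F (z * u) v))//; lin.
Qed.

Lemma comul_eps_t' G (F : H -> H -> G) h : bil F ->
  Σ[x, y <- Δ (εt h)] F x y = Σ[x, y <- Δ 1] F (x * εt h) y.
Proof.
move=> bF; rewrite comul_eps_t_1// (comul1_r (F := fun x u v => _)); last by lin.
rewrite klift_exchange; apply: eq_klift => u v.
by rewrite (eps_tE (F := fun z => F (u * z) v))//; lin.
Qed.

Lemma comul_eps_s_1 G (F : H -> H -> G) h : bil F ->
  Σ[x, y <- Δ (εs h)] F x y =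
  Σ[x, y <- Δ 1] Σ[u, v <- Δ y] ε (h * v) *: F x u.
Proof.
move=> bF; rewrite (eps_sE _ (lin_comul bF)).
rewrite -(comul_assoc (F := fun x u v => ε (h * v) *: F x u)); last by lin.
by apply: eq_klift => x y; rewrite klift_scaler.
Qed.

Lemma comul_eps_s G (F : H -> H -> G) h : bil F ->
  Σ[x, y <- Δ (εs h)] F x y = Σ[x, y <- Δ 1] F x (εs h * y).
Proof.
move=> bF; rewrite comul_eps_s_1// (comul1_r (F := fun x u v => _)); last by lin.
apply: eq_klift => x y.
by rewrite (eps_sE (F := fun z => F x (z * y)))//; lin.
Qed.

Lemma comul_eps_s' G (F : H -> H -> G) h : bil F ->
  Σ[x, y <- Δ (εs h)] F x y = Σ[x, y <- Δ 1] F x (y * εs h).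
Proof.
move=> bF; rewrite comul_eps_s_1// (comul1_l (F := fun x u v => _)); last by lin.
apply: eq_klift => x y.
by rewrite (eps_sE (F := fun z => F x (y * z)))//; lin.
Qed.

Lemma comul_mul_eps_t G (F : H -> H -> G) h l : bil F ->
  Σ[x, y <- Δ (h * εt l)] F x y = Σ[x, y <- Δ h] F (x * εt l) y.
Proof.
move=> bF; rewrite comul_mul// -[in RHS](mulr1 h) [RHS]comul_mul; last by lin.
apply: eq_klift => x y; rewrite comul_eps_t'; last by lin.
by apply: eq_klift => u v; rewrite mulrA.
Qed.

Lemma comul_eps_s_mul G (F : H -> H -> G) h l : bil F ->
  Σ[x, y <- Δ (εs l * h)] F x y = Σ[x, y <- Δ h] F x (εs l * y).
Proof.
move=> bF; rewrite comul_mul// -[in RHS](mul1r h) [RHS]comul_mul; last by lin.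
rewrite comul_eps_s; last by lin.
by apply: eq_klift => x y; apply: eq_klift => u v; rewrite mulrA.
Qed.

(** With h written as 1 h, the Δ(1) inside εt and the one inside Δ(1 h) merge into Δ^2(1), whose
    middle leg is then absorbed by the counit. [comul_eps_s_id] is the mirror image. *)
Lemma comul_id_eps_t G (F : H -> H -> G) h : bil F ->
  Σ[x, y <- Δ h] F x (εt y) = Σ[x, y <- Δ 1] F (x * h) y.
Proof.
move=> bF.
have lF y : lin (fun x => F x y) by lin.
transitivity (Σ[u, v <- Δ 1] Σ[x, y <- Δ (1 * h)] ε (u * y) *: F x v).
  rewrite klift_exchange mul1r; apply: eq_klift => x y.
  by rewrite (eps_tE (F := F x))//; lin.
transitivity (Σ[u, v <- Δ 1] Σ[x, y <- Δ 1] Σ[p, q <- Δ h] ε (u * y * q) *: F (x * p) v).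
  apply: eq_klift => u v; rewrite comul_mul; last by lin.
  by apply: eq_klift => x y; apply: eq_klift => p q; rewrite mulrA.
rewrite klift_exchange.
rewrite -(comul1_r (F := fun x a b => Σ[p, q <- Δ h] ε (a * q) *: F (x * p) b)); last by lin.
rewrite -(comul_assoc (F := fun x a b => Σ[p, q <- Δ h] ε (a * q) *: F (x * p) b));
  last by lin.
apply: eq_klift => x y; rewrite -(comul_counitr _ (lF y)) comul_mul//; lin.
Qed.

Lemma comul_eps_s_id G (F : H -> H -> G) h : bil F ->
  Σ[x, y <- Δ h] F (εs x) y = Σ[x, y <- Δ 1] F x (h * y).
Proof.
move=> bF.
have lF x : lin (F x) by lin.
transitivity (Σ[x, y <- Δ 1] Σ[p, q <- Δ (h * 1)] ε (p * y) *: F x q).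
  rewrite klift_exchange mulr1; apply: eq_klift => p q.
  by rewrite (eps_sE (F := fun z => F z q))//; lin.
transitivity (Σ[x, y <- Δ 1] Σ[u, v <- Δ 1] Σ[p, q <- Δ h] ε (p * (u * y)) *: F x (q * v)).
  apply: eq_klift => x y; rewrite comul_mul; last by lin.
  rewrite klift_exchange.
  by apply: eq_klift => u v; apply: eq_klift => p q; rewrite mulrA.
rewrite -(comul1_r (F := fun x a b => Σ[p, q <- Δ h] ε (p * a) *: F x (q * b))); last by lin.
apply: eq_klift => x y; rewrite -(comul_counitl _ (lF x)) comul_mul; last by lin.
by rewrite klift_exchange.
Qed.

(** Both sides equal ε(g 1_1) ε(1_2 h_1) F(1_3 h_2): the right one by the counit axiom, the left one
    by weak multiplicativity of ε. *)
Lemma comul_counit_mul G (F : H -> G) g h : lin F ->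
  Σ[x, y <- Δ h] ε (g * x) *: F y = Σ[x, y <- Δ 1] ε (g * x) *: F (y * h).
Proof.
move=> lF.
transitivity (Σ[x, y <- Δ 1] Σ[a, b <- Δ y] Σ[p, q <- Δ h]
    (ε (g * x) * ε (a * p)) *: F (b * q)); last first.
  apply: eq_klift => x y; rewrite -(comul_counitl _ lF) comul_mul; last by lin.
  rewrite klift_scaler; apply: eq_klift => a b; rewrite klift_scaler.
  by apply: eq_klift => p q; rewrite scalerA.
rewrite (comul1_l (F := fun x a b => Σ[p, q <- Δ h] _)); last by lin.
rewrite klift_exchange -[in LHS](mul1r h) comul_mul; last by lin.
apply: eq_klift => u v; rewrite klift_exchange; apply: eq_klift => p q.
rewrite -[g in LHS]mulr1 counitML klift_scalel.
by apply: eq_klift => x y; rewrite mulrA.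
Qed.

Lemma counit_eps_s h l : ε (εs h * l) = ε (h * l).
Proof.
rewrite -[h in RHS]mulr1 counitMR (eps_sE (G := k^o) (F := fun z => ε (z * l)))//; lin.
Qed.

Lemma counit_eps_t h l : ε (h * εt l) = ε (h * l).
Proof.
rewrite -[h in RHS]mulr1 counitMR (eps_tE (G := k^o) (F := fun z => ε (h * z))); last by lin.
by apply: eq_klift => x y; rewrite mulrC.
Qed.

Lemma eps_s_mul h l : εs (εs h * l) = εs (h * l).
Proof. by apply: eq_klift => x y; rewrite -mulrA counit_eps_s mulrA. Qed.

Lemma eps_t_mul h l : εt (h * εt l) = εt (h * l).
Proof. by apply: eq_klift => x y; rewrite !mulrA counit_eps_t. Qed.

Lemma eps_s_idem h : εs (εs h) = εs h.
Proof. by rewrite -[X in εs X]mulr1 eps_s_mul mulr1. Qed.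

Lemma eps_t_idem h : εt (εt h) = εt h.
Proof. by rewrite -[X in εt X]mul1r eps_t_mul mul1r. Qed.

Lemma eps_t1 : εt 1 = 1.
Proof. by rewrite -[RHS](counitL C); apply: eq_klift => x y; rewrite mulr1. Qed.

Lemma eps_s1 : εs 1 = 1.
Proof. by rewrite -[RHS](counitR C); apply: eq_klift => x y; rewrite mul1r. Qed.

Lemma comul1_eps_t G (F : H -> H -> G) : bil F ->
  Σ[x, y <- Δ 1] F x (εt y) = Σ[x, y <- Δ 1] F x y.
Proof.
by move=> bF; rewrite comul_id_eps_t//; apply: eq_klift => x y; rewrite mulr1.
Qed.

Lemma comul1_eps_s G (F : H -> H -> G) : bil F ->
  Σ[x, y <- Δ 1] F (εs x) y = Σ[x, y <- Δ 1] F x y.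
Proof.
by move=> bF; rewrite comul_eps_s_id//; apply: eq_klift => x y; rewrite mul1r.
Qed.

End WeakHopfIdentities.

Arguments comul_counitl {k H C G F} h _.
Arguments comul_counitr {k H C G F} h _.
Arguments comul_mul {k H C G F} h l _.
Arguments comul1_l {k H C G F} _.
Arguments comul1_r {k H C G F} _.
Arguments eps_tE {k H C G F} h _.
Arguments eps_sE {k H C G F} h _.
Arguments comul_eps_t {k H C G F} h _.
Arguments comul_eps_t' {k H C G F} h _.
Arguments comul_eps_s {k H C G F} h _.
Arguments comul_eps_s' {k H C G F} h _.
Arguments comul_mul_eps_t {k H C G F} h l _.
Arguments comul_eps_s_mul {k H C G F} h l _.
Arguments comul_id_eps_t {k H C G F} h _.
Arguments comul_eps_s_id {k H C G F} h _.
Arguments comul_counit_mul {k H C G F} g h _.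
Arguments comul1_eps_t {k H C G F} _.
Arguments comul1_eps_s {k H C G F} _.

(** * The antipode: antimultiplicativity and its square *)

Section Antipode.
Variables (k : fieldType) (H : algType k) (C : weakHopf H).
Implicit Types (G : lmodType k) (g h l : H).
Local Notation Δ := (comul C).
Local Notation ε := (counit C).
Local Notation S := (antipode C).
Local Notation εt := (eps_t C).
Local Notation εs := (eps_s C).

Lemma lin_eps_t : lin εt.
Proof. by rewrite /eps_t; lin. Qed.

Lemma lin_eps_s : lin εs.
Proof. by rewrite /eps_s; lin. Qed.

(* The tactic lin looks for such facts in the context. *)
Let lt := lin_eps_t.
Let ls := lin_eps_s.

Lemma antipode_idE h : Σ[x, y <- Δ h] S x * y = εs h.
Proof. exact: antipodeL. Qed.

Lemma id_antipodeE h : Σ[x, y <- Δ h] x * S y = εt h.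
Proof. exact: antipodeR. Qed.

Lemma eps_s_antipode h : Σ[x, y <- Δ h] εs x * S y = S h.
Proof.
rewrite -[RHS](antipodeM C); apply: eq_klift => x y.
by rewrite -antipode_idE.
Qed.

Lemma antipode_eps_t h : Σ[x, y <- Δ h] S x * εt y = S h.
Proof.
rewrite -[RHS]eps_s_antipode.
transitivity (Σ[x, y <- Δ h] Σ[u, v <- Δ y] S x * u * S v).
  apply: eq_klift => x y; rewrite -id_antipodeE klift_mull.
  by apply: eq_klift => u v; rewrite mulrA.
rewrite -(comul_assoc (F := fun x u v => S x * u * S v)); last by lin.
by apply: eq_klift => x y; rewrite -antipode_idE klift_mulr.
Qed.

Lemma comul1_mul_antipode h : Σ[x, y <- Δ 1] x * S (h * y) = S h.
Proof.
by rewrite -[RHS]eps_s_antipode (comul_eps_s_id (F := fun x y => x * S y))//; lin.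
Qed.

(** In S = S * εt the factor εt acts trivially on the second leg of Δ(1), so at an element of H_t
    only S * id = εs remains. *)
Lemma antipode_of_eps_t h : S (εt h) = εs (εt h).
Proof.
rewrite -antipode_eps_t (comul_eps_t' (F := fun x y => S x * εt y)); last by lin.
rewrite (comul1_eps_t (F := fun x y => S (x * εt h) * y)); last by lin.
by rewrite -antipode_idE (comul_eps_t' (F := fun x y => S x * y))//; lin.
Qed.

Lemma antipode_of_eps_s h : S (εs h) = εt (εs h).
Proof.
rewrite -eps_s_antipode (comul_eps_s (F := fun x y => εs x * S y)); last by lin.
rewrite (comul1_eps_s (F := fun x y => x * S (εs h * y))); last by lin.
by rewrite -id_antipodeE (comul_eps_s (F := fun x y => x * S y))//; lin.
Qed.

Lemma antipode1 : S 1 = 1.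
Proof. by rewrite -[in LHS](eps_t1 C) antipode_of_eps_t (eps_t1 C) (eps_s1 C). Qed.

(** The legs of Δ(1) lie in H_s and H_t, where S coincides with εt and εs. Expanding these maps
    yields three copies of Δ(1) linked by ε, which contract to one. *)
Lemma comul1_antipode G (F : H -> H -> G) : bil F ->
  Σ[x, y <- Δ 1] F (S y) (S x) = Σ[x, y <- Δ 1] F x y.
Proof.
move=> bF.
rewrite -(comul1_eps_t (F := fun x y => F (S y) (S x))); last by lin.
rewrite -(comul1_eps_s (F := fun x y => F (S (εt y)) (S x))); last by lin.
transitivity (Σ[x, y <- Δ 1] F (εs (εt y)) (εt (εs x))).
  by apply: eq_klift => x y; rewrite antipode_of_eps_t antipode_of_eps_s.
rewrite (comul1_eps_t (F := fun x y => F (εs y) (εt (εs x)))); last by lin.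
rewrite (comul1_eps_s (F := fun x y => F (εs y) (εt x))); last by lin.
transitivity (Σ[x, y <- Δ 1] Σ[u, v <- Δ 1] Σ[p, q <- Δ 1] (ε (y * v) * ε (p * x)) *: F u q).
  apply: eq_klift => x y; rewrite (eps_sE (F := fun z => F z (εt x))); last by lin.
  apply: eq_klift => u v; rewrite (eps_tE (F := F u)); last by lin.
  by rewrite klift_scaler; apply: eq_klift => p q; rewrite scalerA.
rewrite klift_exchange.
transitivity (Σ[u, v <- Δ 1] Σ[p, q <- Δ 1] ε (p * v) *: F u q).
  apply: eq_klift => u v; rewrite klift_exchange; apply: eq_klift => p q.
  rewrite -[X in X * v]mulr1 counitML klift_scalel.
  by apply: eq_klift => x y; rewrite mulrC.
rewrite -(comul1_r (F := fun u x q => ε x *: F u q)); last by lin.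
by apply: eq_klift => u v; rewrite (comul_counitl (F := F u))//; lin.
Qed.

Lemma antipode_eps_s_mul h l : Σ[x, y <- Δ l] S x * (εs h * y) = εs (h * l).
Proof.
rewrite -eps_s_mul -[RHS]antipode_idE (comul_eps_s_mul (F := fun x y => S x * y))//; lin.
Qed.

Lemma mul_eps_t_antipode h l : Σ[x, y <- Δ h] x * εt l * S y = εt (h * l).
Proof.
rewrite -eps_t_mul -[RHS]id_antipodeE (comul_mul_eps_t (F := fun x y => x * S y))//; lin.
Qed.

(* Both sides are the convolution inverse of the product H (x) H -> H: with
   K (h, l) = S l * S h one has K = K * (m * K) and S \o m = (S \o m) * m * K. *)
Lemma antipode_mul h l : S (h * l) = S l * S h.
Proof.
transitivity (Σ[x, y <- Δ h] Σ[a, b <- Δ l] εs (x * a) * (S b * S y)); last first.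
  transitivity (Σ[x, y <- Δ h] Σ[a, b <- Δ l] Σ[c, d <- Δ a] S c * (εs x * d) * (S b * S y)).
    apply: eq_klift => x y; apply: eq_klift => a b.
    by rewrite -antipode_eps_s_mul klift_mulr.
  rewrite -[S l]antipode_eps_t -[S h]eps_s_antipode klift_mull; apply: eq_klift => x y.
  rewrite (comul_assoc (F := fun c d b => S c * (εs x * d) * (S b * S y))); last by lin.
  rewrite klift_mulr; apply: eq_klift => a b.
  rewrite mulrA -[S a * _ * _]mulrA eps_t_comm -id_antipodeE klift_mull klift_mull klift_mulr.
  by apply: eq_klift => c d; rewrite !mulrA.
rewrite -antipode_eps_t comul_mul; last by lin.
transitivity (Σ[x, y <- Δ h] Σ[a, b <- Δ l] Σ[u, v <- Δ y] Σ[c, d <- Δ b]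
    S (x * a) * (u * c) * (S d * S v)).
  apply: eq_klift => x y; apply: eq_klift => a b.
  rewrite -mul_eps_t_antipode klift_mull; apply: eq_klift => u v.
  rewrite -id_antipodeE !(klift_mulr, klift_mull).
  by apply: eq_klift => c d; rewrite !mulrA.
transitivity (Σ[x, y <- Δ h] Σ[a, b <- Δ l] Σ[u, v <- Δ x] Σ[c, d <- Δ a]
    S (u * c) * (v * d) * (S b * S y)); last first.
  apply: eq_klift => x y; apply: eq_klift => a b.
  rewrite -antipode_idE comul_mul; last by lin.
  rewrite klift_mulr; apply: eq_klift => u v; rewrite klift_mulr.
  by apply: eq_klift => c d.
transitivity (Σ[x, y <- Δ h] Σ[u, v <- Δ y] Σ[a, b <- Δ l] Σ[c, d <- Δ b]
    S (x * a) * (u * c) * (S d * S v)).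
  by apply: eq_klift => x y; rewrite klift_exchange.
rewrite -(comul_assoc (F := fun x u v => Σ[a, b <- Δ l] Σ[c, d <- Δ b]
    S (x * a) * (u * c) * (S d * S v))); last by lin.
apply: eq_klift => x y; rewrite [RHS]klift_exchange; apply: eq_klift => u v.
by rewrite -(comul_assoc (F := fun a c d => S (u * a) * (v * c) * (S d * S y)))//; lin.
Qed.

(** The counterpart for Δ of id * S = εt: the convolution product of Δ with h |-> S(h_2) (x) S(h_1)
    is Δ \o εt. *)
Lemma comul_mul_antipode G (F : H -> H -> G) h : bil F ->
  Σ[x, y <- Δ (εt h)] F x y =
  Σ[a, b <- Δ h] Σ[c, d <- Δ a] Σ[e, f <- Δ b] F (c * S f) (d * S e).
Proof.
move=> bF; rewrite comul_eps_t'//.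
rewrite (comul_assoc (F := fun c d b => Σ[e, f <- Δ b] F (c * S f) (d * S e))); last by lin.
transitivity (Σ[a, b <- Δ h] Σ[c, d <- Δ b] F (a * S d) (εt c)); last first.
  apply: eq_klift => a b.
  rewrite -(comul_assoc (F := fun d e f => F (a * S f) (d * S e))); last by lin.
  apply: eq_klift => c d; rewrite -id_antipodeE.
  by rewrite (lin_klift (L := F (a * S d)))//; lin.
rewrite -(comul_assoc (F := fun a c d => F (a * S d) (εt c))); last by lin.
transitivity (Σ[a, b <- Δ h] Σ[x, y <- Δ 1] F (x * a * S b) y); last first.
  apply: eq_klift => a b.
  by rewrite (comul_id_eps_t (F := fun c d => F (c * S b) d))//; lin.
rewrite klift_exchange; apply: eq_klift => x y.
rewrite -id_antipodeE klift_mull (lin_klift (L := fun z => F z y)); last by lin.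
by apply: eq_klift => a b; rewrite mulrA.
Qed.

(* As for antipode_mul, by uniqueness of the convolution inverse of Δ. *)
Lemma comul_antipode G (F : H -> H -> G) h : bil F ->
  Σ[x, y <- Δ (S h)] F x y = Σ[x, y <- Δ h] F (S y) (S x).
Proof.
move=> bF.
transitivity (Σ[a, b <- Δ h] Σ[e, f <- Δ b] Σ[x, y <- Δ (εs a)] F (x * S f) (y * S e)).
  rewrite -{1}[S h]antipode_eps_t (lin_klift _ _ (lin_comul C bF)).
  transitivity (Σ[a, b <- Δ h] Σ[c, d <- Δ b] Σ[e, f <- Δ d]
      Σ[x, y <- Δ (S a * c)] F (x * S f) (y * S e)).
    apply: eq_klift => a b; rewrite comul_mul// klift_exchange.
    rewrite (comul_mul_antipode (F := fun u v => Σ[x, y <- Δ (S a)] F (x * u) (y * v)));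
      last by lin.
    apply: eq_klift => p q; rewrite klift_exchange; apply: eq_klift => e f.
    rewrite (comul_mul (F := fun x y => F (x * S f) (y * S e))); last by lin.
    rewrite [RHS]klift_exchange; apply: eq_klift => c d; apply: eq_klift => x y.
    by rewrite !mulrA.
  rewrite -(comul_assoc (F := fun a c d => Σ[e, f <- Δ d]
    Σ[x, y <- Δ (S a * c)] F (x * S f) (y * S e))); last by lin.
  apply: eq_klift => a b; rewrite klift_exchange; apply: eq_klift => e f.
  by rewrite -antipode_idE [RHS](lin_klift (L := fun z => Σ[x, y <- Δ z]
    F (x * S f) (y * S e)))//; lin.
transitivity (Σ[a, b <- Δ h] Σ[c, e <- Δ b] Σ[x, y <- Δ 1]
    F (x * S e) (y * (εs a * S c))).
  apply: eq_klift => a b; apply: eq_klift => e f.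
  rewrite (comul_eps_s' (F := fun x y => F (x * S f) (y * S e))); last by lin.
  by apply: eq_klift => x y; rewrite mulrA.
rewrite -(comul_assoc (F := fun a c e => Σ[x, y <- Δ 1]
  F (x * S e) (y * (εs a * S c)))); last by lin.
transitivity (Σ[a, b <- Δ h] Σ[x, y <- Δ 1] F (S y * S b) (S x * S a)).
  apply: eq_klift => a b.
  rewrite (comul1_antipode (F := fun x y => F (x * S b) (y * S a))); last by lin.
  rewrite klift_exchange; apply: eq_klift => x y.
  by rewrite -(eps_s_antipode a) klift_mull (lin_klift (L := F (x * S b)))//; lin.
rewrite -[in RHS](mulr1 h) (comul_mul (F := fun x y => F (S y) (S x))); last by lin.
by apply: eq_klift => a b; apply: eq_klift => x y; rewrite !antipode_mul.
Qed.

Lemma comul_antipode2 G (F : H -> H -> G) h : bil F ->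
  Σ[x, y <- Δ (S (S h))] F x y = Σ[x, y <- Δ h] F (S (S x)) (S (S y)).
Proof.
move=> bF; rewrite comul_antipode//.
by rewrite (comul_antipode (F := fun x y => F (S y) (S x)))//; lin.
Qed.

Lemma comul_eps_t_id G (F : H -> H -> G) h : bil F ->
  Σ[x, y <- Δ h] F (εt x) y = Σ[x, y <- Δ 1] F (S x) (y * h).
Proof.
move=> bF.
rewrite -[RHS](comul1_eps_s (F := fun x y => F (S x) (y * h))); last by lin.
transitivity (Σ[x, y <- Δ 1] F (εt x) (y * h)); last first.
  rewrite -(comul1_eps_s (F := fun x y => F (εt x) (y * h))); last by lin.
  by apply: eq_klift => x y; rewrite antipode_of_eps_s.
transitivity (Σ[u, v <- Δ 1] Σ[x, y <- Δ h] ε (u * x) *: F v y).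
  rewrite klift_exchange; apply: eq_klift => x y.
  by rewrite (eps_tE (F := fun z => F z y))//; lin.
transitivity (Σ[u, v <- Δ 1] Σ[x, y <- Δ 1] ε (u * x) *: F v (y * h)).
  by apply: eq_klift => u v; rewrite (comul_counit_mul (F := F v))//; lin.
rewrite klift_exchange; apply: eq_klift => x y.
by rewrite (eps_tE (F := fun z => F z (y * h)))//; lin.
Qed.

(** The inserted factor S^2(l_2) S(l_1) equals S(l_1 S(l_2)) and is absorbed by Δ(1). Its purpose is
    to complete y S^2(l) to a full coproduct Δ(h S^2(l_2)) inside a trace. *)
Lemma comul_mul_antipode2 G (F : H -> H -> G) h l : bil F ->
  Σ[x, y <- Δ h] F x (y * S (S l)) =
  Σ[x, y <- Δ h] Σ[a, b <- Δ l] Σ[c, d <- Δ b] F (x * S (S c) * S a) (y * S (S d)).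
Proof.
move=> bF.
transitivity (Σ[x, y <- Δ h] Σ[a, b <- Δ l] F (x * S (εt a)) (y * S (S b))); last first.
  apply: eq_klift => x y.
  rewrite -(comul_assoc (F := fun a c d => F (x * S (S c) * S a) (y * S (S d)))); last by lin.
  apply: eq_klift => a b; rewrite -id_antipodeE.
  rewrite (lin_klift (L := fun z => F (x * S z) (y * S (S b)))); last by lin.
  by apply: eq_klift => c d; rewrite antipode_mul mulrA.
transitivity (Σ[x, y <- Δ h] Σ[a, b <- Δ 1] F (x * a) (y * b * S (S l))).
  rewrite -[in LHS](mulr1 h) (comul_mul (F := fun x y => F x (y * S (S l))))//; lin.
apply: eq_klift => x y.
rewrite (comul_eps_t_id (F := fun a b => F (x * S a) (y * S (S b)))); last by lin.
(* Reading Δ(1) as Δ(S^2(1)) puts S^2 on both of its legs. *)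
rewrite -{1}antipode1 -{1}antipode1.
rewrite (comul_antipode2 (F := fun a b => F (x * a) (y * b * S (S l)))); last by lin.
by apply: eq_klift => a b; rewrite !antipode_mul mulrA.
Qed.

End Antipode.

Arguments lin_eps_t {k H C}.
Arguments lin_eps_s {k H C}.
Arguments comul1_antipode {k H C G F} _.
Arguments comul_antipode {k H C G F} h _.
Arguments comul_mul_antipode2 {k H C G F} h l _.
Arguments comul_antipode2 {k H C G F} h _.

(** * Traces, functionals with values in H_t, and the separability integral *)

Section Integrals.
Variables (k : fieldType) (H : falgType k) (C : weakHopf H).
Implicit Types (G : lmodType k) (h l : H).
Local Notation Δ := (comul C).
Local Notation ε := (counit C).
Local Notation S := (antipode C).
Local Notation εt := (eps_t C).
Local Notation εs := (eps_s C).

Let lt : lin εt := lin_eps_t.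
Let ls : lin εs := lin_eps_s.

Definition fbasis (i : 'I_(\dim {:H})) : H := (vbasis {:H})`_i.
Definition fcoord (i : 'I_(\dim {:H})) (h : H) : k := coord (vbasis {:H}) i h.
Local Notation e := fbasis.
Local Notation c := fcoord.

Lemma lin_fcoord i : lin (c i : H -> k^o).
Proof. by move=> a x y; rewrite /fcoord linearP. Qed.

Let lc := lin_fcoord.

Lemma fbasisE G (F : H -> G) h : lin F -> F h = \sum_i c i h *: F (e i).
Proof.
move=> lF; rewrite {1}(coord_vbasis (memvf h)) (lin_sum _ _ lF).
by apply: eq_bigr => i _; rewrite (linZ _ _ lF).
Qed.

(* The trace of z |-> y_1 phi(y_2) for y = h S^2(z): the projection of phi onto
   the coinvariants of the Hopf module H^*. *)
Definition integral (phi : H -> k) h : k :=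
  \sum_i Σ[p, q <- Δ (h * S (S (e i)))] (phi q * c i p : k^o).

Section OneFunctional.
Variables (phi : H -> k) (lphi : lin (phi : H -> k^o)).

Lemma lin_integral : lin (integral phi : H -> k^o).
Proof. by rewrite /integral; lin. Qed.

(** Completing the coproduct inside the trace leaves a stray factor S(a); once cyclicity has moved
    it next to the leg it pairs with, z_1 S(z_2) = εt(z) appears. *)
Lemma comul_integral_trace G (F : H -> G) h : lin F ->
  Σ[x, y <- Δ h] integral phi y *: F x =
  \sum_j Σ[z, w <- Δ (h * S (S (e j)))] Σ[p, q <- Δ w] (phi q * c j p) *: F (εt z).
Proof.
move=> lF.
transitivity (\sum_i Σ[x, y <- Δ h] Σ[p, q <- Δ (y * S (S (e i)))]
    (phi q * c i p) *: F x).
  rewrite -klift_sum; apply: eq_klift => x y; rewrite scaler_suml.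
  by apply: eq_bigr => i _; rewrite klift_scalel.
transitivity (\sum_i Σ[a, b <- Δ (e i)] Σ[z, w <- Δ (h * S (S b))] Σ[p, q <- Δ w]
    (phi q * c i p) *: F (z * S a)).
  apply: eq_bigr => i _.
  rewrite (comul_mul_antipode2 (F := fun x z => Σ[p, q <- Δ z] (phi q * c i p) *: F x));
    last by lin.
  rewrite klift_exchange; apply: eq_klift => a b.
  rewrite (comul_mul (F := fun z w => Σ[p, q <- Δ w] (phi q * c i p) *: F (z * S a)));
    last by lin.
  apply: eq_klift => x y.
  by rewrite [RHS](comul_antipode2 (F := fun u v => Σ[p, q <- Δ (y * v)]
    (phi q * c i p) *: F (x * u * S a)))//; lin.
(* Cyclicity of the trace: expanding b in the basis and resumming over i moves Δ from [e i] to p. *)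
transitivity (\sum_j Σ[z, w <- Δ (h * S (S (e j)))] Σ[p, q <- Δ w] Σ[a, b <- Δ p]
    (phi q * c j b) *: F (z * S a)).
  pose W i b a := Σ[z, w <- Δ (h * S (S b))] Σ[p, q <- Δ w] (phi q * c i p) *: F (z * S a).
  transitivity (\sum_i \sum_j Σ[a, b <- Δ (e i)] c j b *: W i (e j) a).
    apply: eq_bigr => i _; rewrite -klift_sum; apply: eq_klift => a b.
    by rewrite -(fbasisE (F := fun b => W i b a))//; rewrite /W; lin.
  rewrite exchange_big; apply: eq_bigr => j _.
  transitivity (\sum_i Σ[z, w <- Δ (h * S (S (e j)))] Σ[p, q <- Δ w] Σ[a, b <- Δ (e i)]
      c i p *: ((phi q * c j b) *: F (z * S a))); last first.
    rewrite -klift_sum; apply: eq_klift => z w; rewrite -klift_sum; apply: eq_klift => p q.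
    rewrite [RHS](fbasisE (F := fun p => Σ[a, b <- Δ p] (phi q * c j b) *: F (z * S a)));
      last by lin.
    by apply: eq_bigr => i _; rewrite klift_scaler.
  apply: eq_bigr => i _; rewrite /W.
  transitivity (Σ[a, b <- Δ (e i)] Σ[z, w <- Δ (h * S (S (e j)))] Σ[p, q <- Δ w]
      c i p *: ((phi q * c j b) *: F (z * S a))).
    apply: eq_klift => a b; rewrite klift_scaler; apply: eq_klift => z w.
    rewrite klift_scaler; apply: eq_klift => p q.
    by rewrite !scalerA; congr (_ *: _); rewrite mulrC mulrAC mulrC mulrA.
  rewrite klift_exchange; apply: eq_klift => z w.
  by rewrite klift_exchange.
apply: eq_bigr => j _; set y := h * _.
transitivity (Σ[z, w <- Δ y] Σ[a, v <- Δ w] Σ[b, q <- Δ v]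
    (phi q * c j b) *: F (z * S a)).
  apply: eq_klift => z w.
  by rewrite (comul_assoc (F := fun a b q => (phi q * c j b) *: F (z * S a)))//; lin.
rewrite -(comul_assoc (F := fun z a v => Σ[b, q <- Δ v] (phi q * c j b) *: F (z * S a)));
  last by lin.
apply: eq_klift => z w; rewrite klift_exchange; apply: eq_klift => b q.
by rewrite -klift_scaler -id_antipodeE (lin_klift _ _ lF).
Qed.

(** The trace expression sees F only through F \o εt, and εt is idempotent. *)
Lemma comul_integral G (F : H -> G) h : lin F ->
  Σ[x, y <- Δ h] integral phi y *: F x = Σ[x, y <- Δ h] integral phi y *: F (εt x).
Proof.
move=> lF; rewrite comul_integral_trace// comul_integral_trace; last by lin.
apply: eq_bigr => j _; apply: eq_klift => z w; apply: eq_klift => p q.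
by rewrite eps_t_idem.
Qed.

End OneFunctional.

(** Since S(e_j) S^2(e_i) = S(S(e_i) e_j), expanding S(e_i) e_j in the basis and resumming over i
    and j leaves the trace of l |-> εs(h S(l)), which is ε(h S(1_1) 1_2) = ε(h). *)
Lemma sum_integral_antipode h : \sum_j integral (c j) (h * S (e j)) = ε h.
Proof.
pose W z i j := Σ[p, q <- Δ (h * S z)] (c j q * c i p : k^o).
transitivity (\sum_j \sum_i W (S (e i) * e j) i j).
  apply: eq_bigr => j _; apply: eq_bigr => i _.
  by rewrite /W antipode_mul mulrA.
transitivity (\sum_l \sum_j \sum_i c l (S (e i) * e j) * W (e l) i j).
  rewrite [RHS]exchange_big; apply: eq_bigr => j _.
  rewrite [RHS]exchange_big; apply: eq_bigr => i _.
  by rewrite [LHS](fbasisE (G := k^o) (F := fun z => W z i j))//; rewrite /W; lin.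
transitivity (\sum_l c l (εs (h * S (e l)))).
  apply: eq_bigr => l _; have lcl := lc l.
  rewrite -antipode_idE (lin_klift _ _ lcl) exchange_big.
  transitivity (Σ[p, q <- Δ (h * S (e l))] \sum_i \sum_j
      (c i p * (c j q * c l (S (e i) * e j)) : k^o)); last first.
    apply: eq_klift => p q.
    rewrite [RHS](fbasisE (G := k^o) (F := fun p => c l (S p * q))); last by lin.
    apply: eq_bigr => i _.
    rewrite (fbasisE (G := k^o) (F := fun q => c l (S (e i) * q))); last by lin.
    by rewrite scaler_sumr.
  rewrite klift_sum; apply: eq_bigr => i _; rewrite klift_sum; apply: eq_bigr => j _.
  rewrite (klift_mull (A := k^o)); apply: eq_klift => p q.
  by rewrite mulrC mulrA [c i p * _]mulrC.
transitivity (Σ[x, y <- Δ 1] (ε (h * S x * y) : k^o)).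
  transitivity (\sum_l Σ[x, y <- Δ 1] c l x *: (ε (h * S (e l) * y) : k^o)).
    apply: eq_bigr => l _; rewrite (eps_sE (G := k^o) _ (lc l)).
    by apply: eq_klift => x y; exact: mulrC.
  rewrite -klift_sum; apply: eq_klift => x y.
  by rewrite -(fbasisE (G := k^o) (F := fun x => ε (h * S x * y)))//; lin.
have -> : ε h = ε (h * εs 1) by rewrite eps_s1 mulr1.
rewrite -antipode_idE klift_mull klift_scalar.
by apply: eq_klift => x y; rewrite mulrA.
Qed.

(** The kernel of εs is a right ideal, hence has a left unit z. Then L = 1 - z annihilates it from
    the left, in particular every h - εs h, while εs z = 0. *)
Lemma separability_integral : semisimple_algebra H ->
  exists L, (forall h, L * h = L * εs h) /\ εs L = 1.
Proof.
move=> ssH; have linear_s : linear εs by move=> a x y; rewrite ls.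
pose f := linfun (Linear linear_s).
have fE x : f x = εs x by rewrite lfunE.
have [x h|z zI zE] := right_ideal_left_unit ssH (I := lker f).
  by rewrite !memv_ker !fE -eps_s_mul => /eqP->; rewrite mul0r (lin0 ls).
have fB x y : εs (x - y) = εs x - εs y by rewrite -!fE raddfB.
exists (1 - z); split=> [h|]; last first.
  by move: zI; rewrite memv_ker fB eps_s1 fE => /eqP->; rewrite subr0.
have /zE zhE : h - εs h \in lker f by rewrite memv_ker fE fB eps_s_idem subrr.
by apply/eqP; rewrite -subr_eq0 -mulrBr mulrBl mul1r zhE subrr.
Qed.

End Integrals.

(** * Galois extensions *)

Section Coaction.
Variables (k : fieldType) (H : falgType k) (C : weakHopf H) (A : algType k).
Variable rho : comoduleAlgebra C A.
Implicit Types (G : lmodType k) (h l : H) (a x y : A).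
Local Notation Δ := (comul C).
Local Notation ε := (counit C).
Local Notation S := (antipode C).
Local Notation εt := (eps_t C).
Local Notation εs := (eps_s C).
Local Notation ρ := (coact rho).

Let lt : lin εt := lin_eps_t.
Let ls : lin εs := lin_eps_s.

Lemma coact_assoc G (F : A -> H -> H -> G) x : tril F ->
  Σ[a, h <- ρ x] Σ[b, l <- ρ a] F b l h = Σ[a, h <- ρ x] Σ[l, m <- Δ h] F a l m.
Proof.
move=> /tril_lift[L lL LE]; have := congr1 L (coactA rho x); rewrite !(lin_klift _ _ lL).
under eq_klift => a h.
  rewrite (lin_klift _ _ lL).
  under eq_klift => u v do rewrite LE.
  over.
move=> ->; apply: eq_klift => a h; rewrite (lin_klift _ _ lL).
by apply: eq_klift => u v; rewrite LE.
Qed.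

Lemma coact_counitE G (F : A -> G) x : lin F -> Σ[a, h <- ρ x] ε h *: F a = F x.
Proof.
move=> lF; rewrite -[in RHS](coact_counit rho x) (lin_klift _ _ lF).
by apply: eq_klift => a h; rewrite (linZ _ _ lF).
Qed.

Lemma coact_mul G (F : A -> H -> G) x y : bil F ->
  Σ[a, h <- ρ (x * y)] F a h = Σ[a, h <- ρ x] Σ[b, l <- ρ y] F (a * b) (h * l).
Proof. by move=> bF; rewrite coactM kmul_klift. Qed.

Lemma lin_coact G (F : A -> H -> G) : bil F -> lin (fun x => Σ[a, h <- ρ x] F a h).
Proof. by move=> bF; lin. Qed.

(** ρ(1) can be written with all second legs in H_t, whichever representative [klift] sums over. *)
Lemma eq_coact1 G (F F' : A -> H -> G) : bil F -> bil F' ->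
  (forall a h, F a (εt h) = F' a (εt h)) ->
  Σ[u, v <- ρ 1] F u v = Σ[u, v <- ρ 1] F' u v.
Proof.
move=> bF bF' FF'; have [s [st ->]] := coact1 rho.
rewrite (lin_sum _ _ (lin_klift_arg bF (lin_id (U := _)))).
rewrite (lin_sum _ _ (lin_klift_arg bF' (lin_id (U := _)))).
rewrite !big_seq; apply: eq_bigr => p ps.
by rewrite !klift_kpure//; have [h _ <-] := st p ps.
Qed.

Lemma coact1_comul G (F : A -> H -> H -> G) : tril F ->
  Σ[u, v <- ρ 1] Σ[x, y <- Δ v] F u x y = Σ[u, v <- ρ 1] Σ[x, y <- Δ 1] F u (v * x) y.
Proof.
move=> [F1 F2 F3]; apply: eq_coact1; [by lin|by lin|move=> a h].
by rewrite (comul_eps_t (F := F a))//; lin.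
Qed.

Lemma coact1_comul' G (F : A -> H -> H -> G) : tril F ->
  Σ[u, v <- ρ 1] Σ[x, y <- Δ v] F u x y = Σ[u, v <- ρ 1] Σ[x, y <- Δ 1] F u (x * v) y.
Proof.
move=> [F1 F2 F3]; apply: eq_coact1; [by lin|by lin|move=> a h].
by rewrite (comul_eps_t' (F := F a))//; lin.
Qed.

(** The comodule analogue of [comul_id_eps_t]: with x written as 1 x, ρ(1) and Δ(1) merge into (ρ
    (x) id) ρ(1), and the counit absorbs the middle leg. *)
Lemma coact_eps_t G (F : A -> H -> G) x : bil F ->
  Σ[a, h <- ρ x] F a (εt h) = Σ[u, v <- ρ 1] F (u * x) v.
Proof.
move=> bF.
transitivity (Σ[u, v <- ρ 1] Σ[q, r <- Δ 1] Σ[a, h <- ρ x] ε (q * v * h) *: F (u * a) r).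
  rewrite klift_exchange.
  transitivity (Σ[q, r <- Δ 1] Σ[a, h <- ρ (1 * x)] ε (q * h) *: F a r).
    rewrite klift_exchange mul1r; apply: eq_klift => a h.
    by rewrite (eps_tE (F := F a))//; lin.
  apply: eq_klift => q r; rewrite coact_mul; last by lin.
  by apply: eq_klift => u v; apply: eq_klift => a h; rewrite mulrA.
rewrite -(coact1_comul' (F := fun u q r => Σ[a, h <- ρ x] ε (q * h) *: F (u * a) r));
  last by lin.
rewrite -(coact_assoc (F := fun u q r => Σ[a, h <- ρ x] ε (q * h) *: F (u * a) r));
  last by lin.
apply: eq_klift => u v.
rewrite -(coact_mul (F := fun a h => ε h *: F a v)); last by lin.
by rewrite (coact_counitE (F := fun a => F a v))//; lin.
Qed.

Lemma coact1_mulr G (F : A -> H -> G) x : bil F ->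
  Σ[u, v <- ρ 1] F (x * u) v = Σ[a, h <- ρ x] Σ[q, r <- Δ 1] ε (h * q) *: F a r.
Proof.
move=> bF; symmetry.
transitivity (Σ[u, v <- ρ 1] Σ[q, r <- Δ 1] Σ[a, h <- ρ x] ε (h * (v * q)) *: F (a * u) r).
  rewrite klift_exchange [RHS]klift_exchange; apply: eq_klift => q r.
  rewrite -[in LHS](mulr1 x) coact_mul; last by lin.
  rewrite [RHS]klift_exchange.
  by apply: eq_klift => u v; apply: eq_klift => a h; rewrite mulrA.
rewrite -(coact1_comul (F := fun u q r => Σ[a, h <- ρ x] ε (h * q) *: F (a * u) r));
  last by lin.
rewrite -(coact_assoc (F := fun u q r => Σ[a, h <- ρ x] ε (h * q) *: F (a * u) r));
  last by lin.
apply: eq_klift => u v; rewrite klift_exchange.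
rewrite -(coact_mul (F := fun a h => ε h *: F a v)); last by lin.
by rewrite (coact_counitE (F := fun a => F a v))//; lin.
Qed.

Lemma coinvE G (F : A -> H -> G) (b : coinv rho) : bil F ->
  Σ[a, h <- ρ (val b)] F a h = Σ[u, v <- ρ 1] F (u * val b) v.
Proof.
move=> bF; have /asboolP -> := coinvP b.
rewrite (lin_klift _ _ (lin_klift_arg bF (lin_id (U := _)))).
by apply: eq_klift => u v; rewrite klift_kpure.
Qed.

(** Coinvariance is defined with b to the right of 1_0. Passing to the left side costs a contraction
    with Δ(1), which is trivial on second legs in H_t. *)
Lemma coinvEl G (F : A -> H -> G) (b : coinv rho) : bil F ->
  Σ[a, h <- ρ (val b)] F a h = Σ[u, v <- ρ 1] F (val b * u) v.
Proof.
move=> bF; rewrite coact1_mulr// coinvE// coinvE; last by lin.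
apply: eq_coact1; [by lin|by lin|move=> a h].
rewrite -(comul_eps_t (F := fun q r => ε q *: F (a * val b) r));
  last by lin.
by rewrite (comul_counitl (F := F (a * val b)))//; lin.
Qed.

(** For every x, id (x) εt sends ρ(x) to 1_0 x (x) 1_1, so it suffices that id (x) εt fixes ρ(x). *)
Lemma coinvariantI x :
  (forall G (F : A -> H -> G), bil F ->
    Σ[a, h <- ρ x] F a h = Σ[a, h <- ρ x] F a (εt h)) -> x \in coinvariant rho.
Proof.
move=> xE; apply/asboolP; rewrite -[LHS]klift_id xE; last exact: bil_kpure.
by rewrite (coact_eps_t (F := @kpure k A H))//; exact: bil_kpure.
Qed.

Lemma coact_coinv_mul G (F : A -> H -> G) (b : coinv rho) x : bil F ->
  Σ[a, h <- ρ (val b * x)] F a h = Σ[a, h <- ρ x] F (val b * a) h.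
Proof.
move=> bF; rewrite coact_mul// coinvEl; last by lin.
rewrite -[in RHS](mul1r x) (coact_mul (F := fun a h => F (val b * a) h)); last by lin.
by apply: eq_klift => u v; apply: eq_klift => a h; rewrite mulrA.
Qed.

Section Trace.
Variables (phi : H -> k) (lphi : lin (phi : H -> k^o)).

Definition trace_fun x : A := Σ[a, h <- ρ x] integral C phi h *: a.

Let lT := lin_integral C lphi.

(** ρ(x_0 T(x_1)) = x_0 (x) x_1 T(x_2), and [comul_integral] puts the second leg into H_t. *)
Lemma trace_fun_coinv x : trace_fun x \in coinvariant rho.
Proof.
suff E G (F : A -> H -> G) : bil F -> Σ[a, h <- ρ (trace_fun x)] F a h =
    Σ[a, h <- ρ x] Σ[l, m <- Δ h] integral C phi m *: F a l.
  apply: coinvariantI => G F bF; rewrite E// E; last by lin.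
  by apply: eq_klift => a h; rewrite (comul_integral C lphi (F := F a))//; lin.
move=> bF; rewrite (lin_klift _ _ (lin_coact bF)).
rewrite -(coact_assoc (F := fun a l m => integral C phi m *: F a l)); last by lin.
by apply: eq_klift => a h; rewrite (linZ _ _ (lin_coact bF)) klift_scaler.
Qed.

Definition trace x : coinv rho := Coinv (trace_fun_coinv x).

Lemma traceD : {morph trace : x y / x + y}.
Proof.
by move=> x y; apply: val_inj; apply: (linD (f := trace_fun)); rewrite /trace_fun; lin.
Qed.

Lemma trace_coinv_mul b x : trace (val b * x) = b * trace x.
Proof.
apply: val_inj; rewrite /= /trace_fun coact_coinv_mul; last by lin.
by rewrite klift_mull; apply: eq_klift => a h; rewrite scalerAr.
Qed.

(* The right-hand side depends on x and y only through beta (x (x) y). *)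
Lemma trace_mulE a x y :
  trace_fun (a * x) * y = Σ[c, l <- ρ y] Σ[a0, a1 <- ρ a] Σ[u0, u1 <- ρ (x * c)]
    integral C phi (a1 * u1 * S l) *: (a0 * u0).
Proof.
transitivity (Σ[a0, a1 <- ρ a] Σ[x0, x1 <- ρ x] Σ[c, l <- ρ y]
    integral C phi (a1 * x1 * εt l) *: (a0 * x0 * c)).
  transitivity (Σ[a0, a1 <- ρ a] Σ[x0, x1 <- ρ x] Σ[u, v <- ρ 1]
      integral C phi (a1 * x1 * v) *: (a0 * x0 * u * y)); last first.
    apply: eq_klift => a0 a1; apply: eq_klift => x0 x1.
    rewrite (coact_eps_t (F := fun c l => integral C phi (a1 * x1 * l) *: (a0 * x0 * c)));
      last by lin.
    by apply: eq_klift => u v; rewrite mulrA.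
  rewrite /trace_fun klift_mulr -[in LHS](mulr1 x) mulrA.
  rewrite (coact_mul (F := fun a h => integral C phi h *: a * y)); last by lin.
  rewrite (coact_mul (F := fun a h => Σ[u, v <- ρ 1]
    integral C phi (h * v) *: (a * u) * y)); last by lin.
  apply: eq_klift => a0 a1; apply: eq_klift => x0 x1; apply: eq_klift => u v.
  by rewrite -scalerAl.
rewrite [RHS]klift_exchange; apply: eq_klift => a0 a1.
transitivity (Σ[c, l <- ρ y] Σ[x0, x1 <- ρ x] Σ[d, m <- ρ c]
    integral C phi (a1 * x1 * m * S l) *: (a0 * x0 * d)); last first.
  apply: eq_klift => c l; rewrite coact_mul; last by lin.
  by apply: eq_klift => x0 x1; apply: eq_klift => d m; rewrite !mulrA.
rewrite [RHS]klift_exchange; apply: eq_klift => x0 x1.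
rewrite (coact_assoc (F := fun d m l =>
  integral C phi (a1 * x1 * m * S l) *: (a0 * x0 * d))); last by lin.
apply: eq_klift => c l; rewrite -id_antipodeE klift_mull.
rewrite (lin_klift _ _ lT) klift_scalel.
by apply: eq_klift => p q; rewrite mulrA.
Qed.

End Trace.
End Coaction.

Arguments coact_assoc {k H C A rho G F} x _.
Arguments coact_counitE {k H C A} rho {G F} x _.
Arguments coact_mul {k H C A rho G F} x y _.
Arguments eq_coact1 {k H C A rho G F F'} _ _ _.
Arguments coact1_comul {k H C A rho G F} _.
Arguments coact_eps_t {k H C A rho G F} x _.
Arguments coact1_mulr {k H C A rho G F} x _.
Arguments coact_coinv_mul {k H C A rho G F} b x _.

(** * Dual basis and separability element from the Galois map *)

Section Galois.
Variables (k : fieldType) (H : falgType k) (C : weakHopf H) (A : algType k).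
Variable rho : comoduleAlgebra C A.
Implicit Types (G : lmodType k) (h l : H).
Local Notation Δ := (comul C).
Local Notation ε := (counit C).
Local Notation S := (antipode C).
Local Notation εt := (eps_t C).
Local Notation εs := (eps_s C).
Local Notation ρ := (coact rho).
Local Notation e := (fbasis (H := H)).
Local Notation c := (fcoord (H := H)).

Let lt : lin εt := lin_eps_t.
Let ls : lin εs := lin_eps_s.
Let lc := @lin_fcoord k H.

Hypothesis gal : weak_galois rho.

(** The list s represents beta^-1 (1 (x)_t h), and F tests its image under beta. *)
Lemma translation_exists h : exists s : seq (A * A),
  forall G (F : A -> H -> G), bil F ->
    \sum_(p <- s) Σ[a, l <- ρ p.2] F (p.1 * a) l = Σ[u, v <- ρ 1] F u (h * v).
Proof.
have [beta [betaE [_ _ surj]]] := gal.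
have [|t _ tE] := surj (kmul (1 ⊗ h) (ρ 1)); first by exists (1 ⊗ h).
exists (repr t) => G F bF; have lF := lin_klift_arg bF (lin_id (U := _)).
have := congr1 (klift F) tE; rewrite {1}[t]tensor_sum raddf_sum.
rewrite kmul_klift// klift_kpure; last by lin.
under [in RHS]eq_klift do rewrite mul1r.
move=> <-; rewrite (lin_sum _ _ lF); apply: eq_bigr => p _; rewrite betaE.
(* The values of [beta] carry a trailing factor ρ(1) from [pure_t]; it is absorbed by writing p.2 as
   p.2 1. *)
rewrite (lin_klift _ _ lF) -[in LHS](mulr1 p.2).
rewrite (coact_mul (F := fun a l => F (p.1 * a) l)); last by lin.
apply: eq_klift => a l; rewrite (lin_klift _ _ lF); apply: eq_klift => b m.
by rewrite klift_kpure// mulrA.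
Qed.

(** Formal sums with equal images under beta are the same tensor over the coinvariants, so they can
    be exchanged under any balanced map. *)
Lemma galois_inj (s s' : seq (A * A)) :
  \sum_(p <- s) Σ[a, l <- ρ p.2] (p.1 * a) ⊗ l =
    \sum_(p <- s') Σ[a, l <- ρ p.2] (p.1 * a) ⊗ l ->
  forall (G : zmodType) (f : A -> A -> G),
    balanced (coinv_ract rho) (coinv_lact rho) f ->
    \sum_(p <- s) f p.1 p.2 = \sum_(p <- s') f p.1 p.2.
Proof.
have [beta [betaE [_ inj _]]] := gal.
have betaP a b : beta (tpure a b) = Σ[b0, l <- ρ b] (a * b0) ⊗ l.
  rewrite betaE -[in RHS](mulr1 b) (coact_mul (F := fun b0 l => (a * b0) ⊗ l)); last by lin.
  by apply: eq_klift => b0 l; apply: eq_klift => u v; rewrite mulrA.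
move=> ss' G f bf.
have tE (r : seq (A * A)) : \sum_(p <- r) f p.1 p.2 =
    tlift f (\sum_(p <- r) tpure p.1 p.2 : tensor (coinv_ract rho) (coinv_lact rho)).
  rewrite (big_morph _ (tliftD bf) (tlift_tzero bf)).
  by apply: eq_bigr => p _; rewrite tlift_pure.
rewrite !tE; congr (tlift f _); apply: inj; rewrite ?in_setE//.
rewrite !raddf_sum; under eq_bigr do rewrite betaP.
by rewrite ss'; under [in RHS]eq_bigr do rewrite betaP.
Qed.

(** Indices are pairs of a basis vector e_i of H and a term p of its translation, with functional x
    |-> T_i(x p.1) and vector p.2. For fixed i the sum over p is a_0 T_i(a_1 S(e_i)); summing over i
    gives a_0 ε(a_1) = a. *)
Lemma galois_dual_basis : exists n (f : 'I_n -> A -> coinv rho) (y : 'I_n -> A),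
  [/\ forall i, {morph f i : x y / x + y},
      forall i b x, f i (val b * x) = b * f i x
    & forall x, x = \sum_i val (f i x) * y i].
Proof.
have [s sE] := choice (fun i => translation_exists (e i)).
pose tr i : A -> coinv rho := trace rho (lc i).
pose L := [seq (i, p) | i <- enum 'I_(\dim {:H}), p <- s i].
exists (size L), (fun j x => tr (tnth (in_tuple L) j).1 (x * (tnth (in_tuple L) j).2.1)).
exists (fun j => (tnth (in_tuple L) j).2.2); split=> [j x y|j b x|a].
- by rewrite /tr mulrDl traceD.
- by rewrite /tr -mulrA trace_coinv_mul.
rewrite -(big_tnth _ _ L xpredT (fun q => val (tr q.1 (a * q.2.1)) * q.2.2)).
rewrite big_allpairs_dep big_enum /=.
transitivity (\sum_i Σ[a0, a1 <- ρ a] integral C (c i) (a1 * S (e i)) *: a0).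
  rewrite -klift_sum -[LHS](coact_counitE rho a (lin_id (U := A))).
  by apply: eq_klift => a0 a1; rewrite -scaler_suml sum_integral_antipode.
apply: eq_bigr => i _; have lT := lin_integral C (lc i).
transitivity (\sum_(p <- s i) Σ[x, l <- ρ p.2] Σ[a0, a1 <- ρ a] Σ[u0, u1 <- ρ (p.1 * x)]
    integral C (c i) (a1 * u1 * S l) *: (a0 * u0)); last first.
  by apply: eq_bigr => p _; rewrite -(trace_mulE rho (lc i)).
rewrite (sE i _ (fun u v => Σ[a0, a1 <- ρ a] Σ[u0, u1 <- ρ u]
  integral C (c i) (a1 * u1 * S v) *: (a0 * u0))); last by lin.
(* Writing S(e_i) as 1_1 S(e_i 1_2) creates the Δ(1) that the other side gets from coassociativity
   at ρ(1). *)
transitivity (Σ[a0, a1 <- ρ a] Σ[u, v <- ρ 1] Σ[x, y <- Δ 1]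
    integral C (c i) (a1 * (v * x) * S (e i * y)) *: (a0 * u)).
  rewrite -[in LHS](mulr1 a) (coact_mul (F := fun a0 a1 =>
    integral C (c i) (a1 * S (e i)) *: a0)); last by lin.
  apply: eq_klift => a0 a1; apply: eq_klift => u v.
  rewrite -(comul1_mul_antipode C (e i)) klift_mull (lin_klift _ _ lT) klift_scalel.
  by apply: eq_klift => x y; rewrite !mulrA.
rewrite [RHS]klift_exchange; apply: eq_klift => a0 a1.
rewrite (coact_assoc (F := fun u0 u1 v =>
  integral C (c i) (a1 * u1 * S (e i * v)) *: (a0 * u0))); last by lin.
by rewrite (coact1_comul (F := fun u x y =>
  integral C (c i) (a1 * x * S (e i * y)) *: (a0 * u)))//; lin.
Qed.

(** Multiplying out gives ε(L 1_1) 1_0, which is 1 because εs L = 1. Under beta, a s and s a become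
    a 1_0 (x) L 1_1 and a_0 (x) L a_1, and L h = L εs(h) makes these equal. *)
Lemma galois_separability : semisimple_algebra H -> exists s : seq (A * A),
  \sum_(p <- s) p.1 * p.2 = 1 /\
  forall (G : zmodType) (f : A -> A -> G),
    balanced (coinv_ract rho) (coinv_lact rho) f ->
    forall a, \sum_(p <- s) f (a * p.1) p.2 = \sum_(p <- s) f p.1 (p.2 * a).
Proof.
move=> /(separability_integral C)[L [LE L1]].
have [s sE] := translation_exists L; exists s; split.
  transitivity (Σ[u, v <- ρ 1] ε (L * v) *: u).
    rewrite -(sE _ (fun u v => ε v *: u)); last by lin.
    by apply: eq_bigr => p _; rewrite (coact_counitE rho (F := fun a => p.1 * a))//; lin.
  rewrite -[RHS](coact_counitE rho 1 (lin_id (U := A))); apply: eq_klift => u v.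
  by rewrite -counit_eps_s L1 mul1r.
move=> G f bf a.
have := @galois_inj [seq (a * p.1, p.2) | p <- s] [seq (p.1, p.2 * a) | p <- s] _ G f bf.
rewrite !big_map /=; apply.
transitivity (Σ[u, v <- ρ 1] (a * u) ⊗ (L * v)).
  rewrite -(sE _ (fun u v => (a * u) ⊗ v)); last by lin.
  by apply: eq_bigr => p _; apply: eq_klift => b l; rewrite mulrA.
transitivity (Σ[d, m <- ρ a] d ⊗ (L * m)); last first.
  rewrite -[in LHS](mul1r a) (coact_mul (F := fun d m => d ⊗ (L * m))); last by lin.
  transitivity (Σ[u, v <- ρ 1] Σ[d, m <- ρ a] (u * d) ⊗ (L * v * m)).
    by apply: eq_klift => u v; apply: eq_klift => d m; rewrite mulrA.
  rewrite -(sE _ (fun u v => Σ[d, m <- ρ a] (u * d) ⊗ (v * m))); last by lin.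
  apply: eq_bigr => p _; rewrite (coact_mul (F := fun b l => (p.1 * b) ⊗ l)); last by lin.
  by apply: eq_klift => b l; apply: eq_klift => d m; rewrite mulrA.
transitivity (Σ[u, v <- ρ 1] (a * u) ⊗ (L * εs v)).
  by apply: eq_klift => u v; rewrite LE.
rewrite (coact1_mulr (F := fun d m => d ⊗ (L * εs m))); last by lin.
apply: eq_klift => d m; rewrite LE.
rewrite (eps_sE (F := fun z => d ⊗ (L * z))); last by lin.
transitivity (Σ[q, r <- Δ 1] Σ[x, y <- Δ 1] (ε (m * q) * ε (r * y)) *: (d ⊗ (L * x))).
  apply: eq_klift => q r; rewrite (eps_sE (F := fun z => d ⊗ (L * z))); last by lin.
  by rewrite klift_scaler; apply: eq_klift => x y; rewrite scalerA.
rewrite klift_exchange; apply: eq_klift => x y.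
by rewrite -[m in RHS]mulr1 counitML klift_scalel.
Qed.

End Galois.

(** * A colinear map j : H -> A with j(1) = 1, by faithfully flat descent *)

Section TotalIntegral.
Variables (k : fieldType) (H : falgType k) (C : weakHopf H) (A : algType k).
Variable rho : comoduleAlgebra C A.
Implicit Types (G : lmodType k) (h l : H).
Local Notation Δ := (comul C).
Local Notation εt := (eps_t C).
Local Notation ρ := (coact rho).
Local Notation e := (fbasis (H := H)).
Local Notation c := (fcoord (H := H)).
Local Notation n := (\dim {:H}).
Local Notation B := (coinv rho).

Let lt : lin εt := lin_eps_t.
Let lc := @lin_fcoord k H.

Definition coinv_incl : {rmorphism B -> A} := \val.

Local Notation AB := (restr coinv_incl A^o).
Local Notation V := {ffun 'I_n -> AB}.
Local Notation W := {ffun 'I_n * 'I_n -> AB}.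

Lemma AB_scale (b : B) (x : AB) : b *: x = val b * (x : A).
Proof. by []. Qed.

(** Hom_k(H, A) is encoded as a finite power of A through the basis of H, so that A (x)_B - can be
    treated coordinatewise. *)
Definition linear_of (j : V) h : A := \sum_i c i h *: (j i : A).

Lemma lin_linear_of j : lin (linear_of j).
Proof. by rewrite /linear_of; lin. Qed.

Lemma linear_ofP (b : B) (j j' : V) h :
  linear_of (b *: j + j') h = val b * linear_of j h + linear_of j' h.
Proof.
rewrite mulr_sumr -big_split; apply: eq_bigr => i _.
by rewrite !ffunE scalerDr AB_scale scalerAr.
Qed.

(* The coordinates of (rho \o j) - (j (x) id) \o Δ, so that the kernel consists
   of the colinear maps H -> A. *)
Definition colin_defect (j : V) : W := [ffun mq =>
  Σ[a, h <- ρ (j mq.1)] c mq.2 h *: (a : A) -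
  Σ[y, z <- Δ (e mq.1)] c mq.2 z *: linear_of j y].

Lemma colin_defect_linear : linear colin_defect.
Proof.
move=> b j j'; apply/ffunP => -[m q]; rewrite !ffunE /=.
have bF : bil (fun (a : A) h => c q h *: a) by have lcq := lc q; lin.
pose K (x : A) := Σ[a, h <- ρ x] c q h *: a.
pose K' j0 := Σ[y, z <- Δ (e m)] c q z *: linear_of j0 y.
have KE : K (val b * (j m : A) + j' m) = val b * K (j m) + K (j' m).
  rewrite /K (linD (lin_coact rho bF)) coact_coinv_mul//; congr (_ + _).
  by rewrite klift_mull; apply: eq_klift => a h; exact: scalerAr.
have KE' : K' (b *: j + j') = val b * K' j + K' j'.
  rewrite /K' klift_mull /klift /tlift /tsum -big_split; apply: eq_bigr => p _ /=.
  by rewrite linear_ofP scalerDr scalerAr.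
rewrite -[LHS]/(K (val b * (j m : A) + j' m) - K' (b *: j + j')) KE KE'.
by rewrite -[RHS]/(val b * (K (j m) - K' j) + (K (j' m) - K' j')) mulrBr opprD addrACA.
Qed.

Definition defect : {linear V -> W} := Linear colin_defect_linear.

Lemma linear_of_basis (j : V) m : linear_of j (e m) = j m.
Proof.
have cE i : c i (e m) = (m == i)%:R := coord_free _ _ (basis_free (vbasisP _)).
rewrite /linear_of (bigD1 m) //= big1 => [|i im].
  by rewrite cE eqxx scale1r addr0.
by rewrite cE eq_sym (negbTE im) scale0r.
Qed.

Lemma colinear_of (j : V) : defect j = 0 ->
  forall G (F : A -> H -> G) h, bil F ->
    Σ[a, l <- ρ (linear_of j h)] F a l = Σ[x, y <- Δ h] F (linear_of j x) y.
Proof.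
move=> j0 G F h bF; have lj := lin_linear_of j.
rewrite [LHS](fbasisE (F := fun h => Σ[a, l <- ρ (linear_of j h)] F a l)); last by lin.
rewrite [RHS](fbasisE (F := fun h => Σ[x, y <- Δ h] F (linear_of j x) y)); last by lin.
apply: eq_bigr => m _; congr (_ *: _); rewrite linear_of_basis.
transitivity (\sum_q F (Σ[a, l <- ρ (j m)] c q l *: (a : A)) (e q)).
  have E q : F (Σ[a, l <- ρ (j m)] c q l *: (a : A)) (e q) =
      Σ[a, l <- ρ (j m)] c q l *: F a (e q).
    rewrite (lin_klift _ _ (bF.1 (e q))); apply: eq_klift => a l.
    by rewrite (linZ _ _ (bF.1 _)).
  under eq_bigr do rewrite E.
  by rewrite -klift_sum; apply: eq_klift => a l; exact: fbasisE (bF.2 a).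
have E q : F (Σ[y, z <- Δ (e m)] c q z *: linear_of j y) (e q) =
    Σ[y, z <- Δ (e m)] c q z *: F (linear_of j y) (e q).
  rewrite (lin_klift _ _ (bF.1 (e q))); apply: eq_klift => y z.
  by rewrite (linZ _ _ (bF.1 _)).
transitivity (\sum_q F (Σ[y, z <- Δ (e m)] c q z *: linear_of j y) (e q)).
  apply: eq_bigr => q _; congr (F _ _); apply/eqP; rewrite -subr_eq0; apply/eqP.
  by have /ffunP/(_ (m, q)) := j0; rewrite !ffunE.
under eq_bigr do rewrite E.
rewrite -klift_sum; apply: eq_klift => y z; symmetry; exact: fbasisE (bF.2 _).
Qed.

(** For colinear j, ρ(j(1)) = j(1_1) (x) 1_2, and the second leg of Δ(1) lies in H_t. *)
Lemma linear_of1_coinv (j : ker defect) : linear_of (val j) 1 \in coinvariant rho.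
Proof.
have lj := lin_linear_of (val j).
apply: coinvariantI => G F bF; rewrite !(colinear_of (ker_inclK j)); [|by lin|by []].
by rewrite (comul1_eps_t (F := fun x y => F (linear_of (val j) x) y))//; lin.
Qed.

Definition eval1 (j : ker defect) : B^o := Coinv (linear_of1_coinv j).

Lemma eval1_linear : linear eval1.
Proof. by move=> b j j'; apply: val_inj; rewrite /= linear_ofP. Qed.

Lemma evalV_linear : linear (fun j : V => linear_of j 1 : AB).
Proof. by move=> b j j'; rewrite linear_ofP. Qed.

Lemma incl_linear : linear (val : B^o -> AB).
Proof. by []. Qed.

Lemma proj_linear (I : finType) (X : lmodType B) (q : I) :
  linear (fun w : {ffun I -> X} => w q).
Proof. by move=> b w w'; rewrite !ffunE. Qed.

Lemma inj_linear (I : finType) (X : lmodType B) (q : I) :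
  linear (fun x : X => [ffun i => if i == q then x else 0] : {ffun I -> X}).
Proof.
move=> b x y; apply/ffunP => i; rewrite !ffunE.
by case: eqP; rewrite ?scaler0 ?addr0.
Qed.

Local Notation proj X q := (Linear (@proj_linear _ X q)).
Local Notation inj X q := (Linear (@inj_linear _ X q)).
Local Notation ext := (extn coinv_incl).
Local Notation emap := (ext_map coinv_incl).

(** The decomposition of the identity into the [inj q \o proj q] survives the additive functor A
    (x)_B -. *)
Lemma ext_ffun0 (I : finType) (X : lmodType B) (t : ext {ffun I -> X}) :
  (forall q, emap (proj X q) t = 0) -> t = 0.
Proof.
move=> t0; suff -> : t = \sum_q emap (inj X q) (emap (proj X q) t).
  by rewrite big1 // => q _; rewrite t0 linear0.
move: t {t0}; apply: tensor_ext => [//|x y|s w].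
  by rewrite -big_split; apply: eq_bigr => q _; rewrite !linearD.
rewrite -[LHS]/(extp coinv_incl s w).
under eq_bigr => q _ do rewrite -[tpure s w]/(extp coinv_incl s w) !ext_mapE.
rewrite -(big_morph _ (extpDr coinv_incl s) (extp0r coinv_incl s)); congr extp.
apply/ffunP => i; rewrite sum_ffunE (bigD1 i)//= big1 => [|q qi]; rewrite !ffunE.
  by rewrite eqxx addr0.
by rewrite eq_sym (negbTE qi).
Qed.

Hypothesis gal : weak_galois rho.
Hypothesis ff : faithfully_flat (ract coinv_incl).

Local Notation phi := coinv_incl.

Lemma ext_balanced : balanced (coinv_ract rho) (coinv_lact rho)
  (fun a (x : A) => extp phi a (x : AB)).
Proof. exact: tpure_balanced (ract phi) (@GRing.scale B AB). Qed.

Lemma linear_of_inj i (x : A) h : linear_of (inj AB i x) h = c i h *: x.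
Proof.
rewrite /linear_of (bigD1 i)//= big1 => [|l il]; rewrite ffunE ?eqxx ?addr0//.
by rewrite (negbTE il); exact: scaler0.
Qed.

Lemma flat_ext (X Y Z : lmodType B) (f : {linear X -> Y}) (g : {linear Y -> Z}) :
  exact f g -> exact (emap f) (emap g).
Proof. exact: (ff f g).1. Qed.

Lemma emap_null (X Y : lmodType B) (t : ext X) : emap (@GRing.null_fun X Y) t = 0.
Proof.
apply: (extn_ext (f := emap (@GRing.null_fun X Y)) (g := @GRing.null_fun _ _)).
by move=> s x; rewrite ext_mapE extp0r.
Qed.

Lemma total_integral_exists : exists j : H -> A,
  [/\ lin j, j 1 = 1 & forall G (F : A -> H -> G) h, bil F ->
    Σ[a, l <- ρ (j h)] F a l = Σ[x, y <- Δ h] F (j x) y].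
Proof.
have [s sE] := choice (fun i => translation_exists gal (e i)).
(* The family h |-> beta^-1 (1 (x)_t h) as one element of A (x)_B Hom_k(H, A); its coordinate at i
   is the translation of [e i]. *)
pose g : ext V := \sum_i \sum_(p <- s i) extp phi p.1 (inj AB i (p.2 : AB)).
have gE (X : lmodType B) (f : {linear V -> X}) :
    emap f g = \sum_i \sum_(p <- s i) extp phi p.1 (f (inj AB i (p.2 : AB))).
  rewrite linear_sum; apply: eq_bigr => i _; rewrite linear_sum.
  by apply: eq_bigr => p _; rewrite ext_mapE.
have dg : emap defect g = 0.
  apply: ext_ffun0 => -[m q].
  pose D1 (x : A) := Σ[a, h <- ρ x] c q h *: a.
  pose K i : k := Σ[y, z <- Δ (e m)] (c q z * c i y : k^o).
  have dE i (x : A) : defect (inj AB i x) (m, q) =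
      (if m == i then D1 x else 0) - K i *: x :> A.
    rewrite ffunE /=; congr (_ - _); last first.
      by rewrite klift_scalel; apply: eq_klift => y z; rewrite linear_of_inj scalerA.
    rewrite ffunE; case: eqP => // _; apply: (lin0 (f := D1)).
    by have lcq := lc q; rewrite /D1; lin.
  have bD : bil (fun (a : A) h => c q h *: a) by have lcq := lc q; lin.
  rewrite gE linear_sum.
  transitivity (\sum_i \sum_(p <- s i)
    (extp phi p.1 ((if m == i then D1 p.2 else 0) : AB) - extp phi p.1 (K i *: p.2 : AB))).
    apply: eq_bigr => i _; rewrite linear_sum; apply: eq_bigr => p _.
    by rewrite ext_mapE -extpBr; congr extp; exact: dE.
  under eq_bigr do rewrite sumrB.
  rewrite sumrB (bigD1 m)//= [X in _ + X - _]big1 => [|i im]; last first.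
    by rewrite big1 // => p _; rewrite eq_sym (negbTE im) extp0r.
  rewrite eqxx addr0; apply/eqP; rewrite subr_eq0; apply/eqP.
  pose s1 := [seq (p.1, D1 p.2) | p <- s m].
  pose s2 := [seq (p.1, K i *: p.2) | i <- enum 'I_n, p <- s i].
  suff /(galois_inj gal)/(_ _ _ ext_balanced) :
      \sum_(p <- s1) Σ[a, l <- ρ p.2] (p.1 * a) ⊗ l =
      \sum_(p <- s2) Σ[a, l <- ρ p.2] (p.1 * a) ⊗ l.
    by rewrite big_map big_allpairs_dep big_enum.
  rewrite big_map big_allpairs_dep big_enum /=.
  (* The common image under beta: applying ρ to the right factors of the translation of [e m]
     amounts to applying Δ to [e m]. *)
  transitivity (Σ[u, v <- ρ 1] Σ[y, z <- Δ (e m)] c q z *: (u ⊗ (y * v))).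
    have lcq := lc q.
    transitivity (Σ[u, v <- ρ 1] Σ[y, z <- Δ (e m * v)] c q z *: (u ⊗ y)); last first.
      apply: eq_coact1; [by lin|by lin|move=> a h].
      by rewrite (comul_mul_eps_t (F := fun y z => c q z *: (a ⊗ y)))//; lin.
    rewrite -(sE m _ (fun u v => Σ[y, z <- Δ v] c q z *: (u ⊗ y))); last by lin.
    apply: eq_bigr => p _.
    rewrite -(coact_assoc (F := fun a y z => c q z *: ((p.1 * a) ⊗ y))); last by lin.
    have bF : bil (fun (a : A) l => (p.1 * a) ⊗ l) by lin.
    rewrite /D1 (lin_klift _ _ (lin_coact rho bF)); apply: eq_klift => a h.
    by rewrite (linZ _ _ (lin_coact rho bF)) klift_scaler.
  transitivity (\sum_i K i *: Σ[u, v <- ρ 1] u ⊗ (e i * v)); last first.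
    apply: eq_bigr => i _; rewrite -(sE i _ (fun u v => u ⊗ v)); last by lin.
    rewrite scaler_sumr; apply: eq_bigr => p _.
    have bF : bil (fun (a : A) l => (p.1 * a) ⊗ l) by lin.
    by rewrite (linZ _ _ (lin_coact rho bF)).
  transitivity (\sum_i Σ[u, v <- ρ 1] Σ[y, z <- Δ (e m)] c i y *: (c q z *: (u ⊗ (e i * v)))).
    rewrite -klift_sum; apply: eq_klift => u v; rewrite -klift_sum; apply: eq_klift => y z.
    by rewrite (fbasisE (F := fun y => c q z *: (u ⊗ (y * v))))//; lin.
  apply: eq_bigr => i _; rewrite klift_scaler; apply: eq_klift => u v.
  rewrite klift_scalel; apply: eq_klift => y z.
  by rewrite scalerA mulrC.
(* By flatness the kernel of the extended defect comes from A (x)_B ker defect. *)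
have [t tE] : exists t, emap (ker_incl defect) t = g.
  by have [_] := iffLR (exactP _ _) (flat_ext (ker_exact defect)); exact.
pose ev : {linear V -> AB} := Linear evalV_linear.
pose ev1 : {linear ker defect -> B^o} := Linear eval1_linear.
pose io : {linear B^o -> AB} := Linear incl_linear.
(* Evaluation at 1 turns the family into beta^-1 (1 (x)_t 1) = 1 (x) 1. The check takes place in A
   (x)_B A, into which A (x)_B B embeds by flatness. *)
have t1 : emap ev1 t = extp phi 1 (1 : B^o).
  have ioi : injective io by exact: val_inj.
  apply: (ext_inj flat_ext ioi); rewrite ext_mapE.
  have -> : emap io (emap ev1 t) = emap ev (emap (ker_incl defect) t).
    apply: (extn_ext (f := emap io \o emap ev1) (g := emap ev \o emap (ker_incl defect))).
    move=> a j; rewrite -[LHS]/(emap io (emap ev1 _)).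
    by rewrite -[RHS]/(emap ev (emap _ _)) !ext_mapE.
  rewrite tE gE.
  pose s1 := [seq (p.1, c i 1 *: p.2) | i <- enum 'I_n, p <- s i].
  pose s2 : seq (A * A) := [:: (1, 1)].
  suff /(galois_inj gal)/(_ _ _ ext_balanced) :
      \sum_(p <- s1) Σ[a, l <- ρ p.2] (p.1 * a) ⊗ l =
      \sum_(p <- s2) Σ[a, l <- ρ p.2] (p.1 * a) ⊗ l.
    rewrite big_seq1 big_allpairs_dep big_enum /= => <-.
    apply: eq_bigr => i _; apply: eq_bigr => p _; congr extp; exact: linear_of_inj.
  rewrite big_seq1 big_allpairs_dep big_enum /=.
  transitivity (Σ[u, v <- ρ 1] u ⊗ v); last first.
    by apply: eq_klift => u v; rewrite mul1r.
  transitivity (\sum_i c i 1 *: Σ[u, v <- ρ 1] u ⊗ (e i * v)).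
    apply: eq_bigr => i _; rewrite -(sE i _ (fun u v => u ⊗ v)); last by lin.
    rewrite scaler_sumr; apply: eq_bigr => p _.
    have bF : bil (fun (a : A) l => (p.1 * a) ⊗ l) by lin.
    by rewrite (linZ _ _ (lin_coact rho bF)).
  rewrite -(fbasisE (F := fun h => Σ[u, v <- ρ 1] u ⊗ (h * v))); last by lin.
  by apply: eq_klift => u v; rewrite mul1r.
(* Surjectivity of ev1, written as exactness before a zero module: after extension the multiples of
   t reach every a (x) b, and faithful flatness reflects this. *)
have : exact ev1 (@GRing.null_fun B^o 'rV[B]_0).
  apply: (ff ev1 (@GRing.null_fun B^o 'rV[B]_0)).2.
  change (exact (emap ev1) (emap (@GRing.null_fun B^o 'rV[B]_0))).
  apply/exactP; split=> [x|y _]; first exact: emap_null.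
  elim/tensor_ind: y => [|x y [x' <-] [y' <-]|a b].
  - by exists 0; rewrite linear0.
  - by exists (x' + y'); rewrite linearD.
  - exists ((a * val (b : B)) *: t); rewrite linearZZ t1 extnZ mulr1.
    by rewrite extpM; congr extp; exact: mulr1.
move=> /exactP[_ /(_ 1 erefl)[j j1]].
exists (linear_of (val j)); split; first exact: lin_linear_of.
  exact: (congr1 val j1).
by move=> G F h bF; apply: colinear_of => //; exact: ker_inclK.
Qed.

End TotalIntegral.

(** * The left linear retraction of A onto its coinvariants *)

Section LeftSplitting.
Variables (k : fieldType) (H : falgType k) (C : weakHopf H) (A : algType k).
Variable rho : comoduleAlgebra C A.
Local Notation Δ := (comul C).
Local Notation ε := (counit C).
Local Notation S := (antipode C).
Local Notation εt := (eps_t C).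
Local Notation εs := (eps_s C).
Local Notation ρ := (coact rho).

Let lt : lin εt := lin_eps_t.
Let ls : lin εs := lin_eps_s.

Variables (j : H -> A) (lj : lin j) (j1 : j 1 = 1).
Hypothesis jE : forall (G : lmodType k) (F : A -> H -> G) h, bil F ->
  Σ[a, l <- ρ (j h)] F a l = Σ[x, y <- Δ h] F (j x) y.

Definition split_fun (x : A) : A := Σ[a, h <- ρ x] a * j (S h).

(** As j is colinear and S reverses Δ, ρ(x_0 j(S(x_1))) = x_0 j(S(x_3)) (x) x_1 S(x_2), whose second
    leg collapses to a value of εt. *)
Lemma split_fun_coinv x : split_fun x \in coinvariant rho.
Proof.
suff E (G : lmodType k) (F : A -> H -> G) : bil F -> Σ[a, l <- ρ (split_fun x)] F a l =
    Σ[a, h <- ρ x] Σ[l, m <- Δ h] F (a * j (S m)) (εt l).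
  apply: coinvariantI => G F bF; rewrite E// E; last by lin.
  by apply: eq_klift => a h; apply: eq_klift => l m; rewrite eps_t_idem.
move=> bF; rewrite (lin_klift _ _ (lin_coact rho bF)).
transitivity (Σ[a, h <- ρ x] Σ[d, l <- ρ a] Σ[u, v <- Δ h] F (d * j (S v)) (l * S u)).
  apply: eq_klift => a h; rewrite coact_mul//; apply: eq_klift => d l.
  rewrite (jE (F := fun b m => F (d * b) (l * m))); last by lin.
  by rewrite (comul_antipode (F := fun p q => F (d * j p) (l * q)))//; lin.
rewrite (coact_assoc (F := fun d l h => Σ[u, v <- Δ h] F (d * j (S v)) (l * S u)));
  last by lin.
apply: eq_klift => a h.
rewrite -(comul_assoc (F := fun l u v => F (a * j (S v)) (l * S u))); last by lin.
apply: eq_klift => l m; rewrite -id_antipodeE.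
by rewrite [RHS](lin_klift _ _ (bF.2 (a * j (S m)))).
Qed.

Definition split (x : A) : coinv rho := Coinv (split_fun_coinv x).

Lemma splitD : {morph split : x y / x + y}.
Proof.
by move=> x y; apply: val_inj; apply: (linD (f := split_fun)); rewrite /split_fun; lin.
Qed.

Lemma split_mul b x : split (val b * x) = b * split x.
Proof.
apply: val_inj; rewrite /= /split_fun coact_coinv_mul; last by lin.
by rewrite klift_mull; apply: eq_klift => a h; rewrite mulrA.
Qed.

(** Colinearity at 1 and j(1) = 1 give j(1_1) (x) 1_2 = ρ(1), which is contracted with ε(h -). *)
Lemma total_integral_eps_s h : j (εs h) = Σ[u, v <- ρ 1] ε (h * v) *: u.
Proof.
rewrite (eps_sE h lj) -(jE (F := fun u v => ε (h * v) *: u)) ?j1//; lin.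
Qed.

(** S equals εs on the second leg of ρ(1), so the value becomes (id (x) ε)(ρ(1) ρ(1)) = 1. *)
Lemma split1 : split 1 = 1.
Proof.
apply: val_inj; rewrite /= /split_fun.
transitivity (Σ[u, v <- ρ 1] u * j (εs v)).
  by apply: eq_coact1; [lin|lin|move=> a h; rewrite antipode_of_eps_t].
rewrite -[RHS](coact_counitE rho 1 (lin_id (U := A))) -[in RHS](mulr1 1).
rewrite [RHS](coact_mul (F := fun a h => ε h *: a)); last by lin.
apply: eq_klift => u v; rewrite total_integral_eps_s klift_mull.
by apply: eq_klift => a h; rewrite scalerAr.
Qed.

End LeftSplitting.

Theorem corollary2p4 (k : fieldType) (H : falgType k) (C : weakHopf H)
    (A : algType k) (rho : comoduleAlgebra C A) :
  weak_galois rho ->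
  faithfully_flat (coinv_ract rho) ->
  semisimple_algebra H ->
  (forall R : falgType k, (fin_dim R < +oo)%E) ->
  fin_dim (coinv rho) = fin_dim A.
Proof.
move=> gal ff ssH _.
have [n [f [y [fD fM fE]]]] := galois_dual_basis gal.
have [s [s1 sC]] := galois_separability gal ssH.
have [j [lj j1 jE]] := total_integral_exists gal ff.
(* [coinv_ract rho] is convertible with [ract (coinv_incl rho)], so flatness and centrality fit as
   they stand. *)
exact: (@fin_dim_extension _ _ (coinv_incl rho) n f y (split lj jE) s ff fD fM fE
  (splitD lj jE) (split_mul lj jE) (split1 lj j1 jE) s1 sC).
Qed.
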